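(* Let $p$ be a prime, $K$ a finite extension of $\mathbb{Q}_p$, and $A\subset K((\frac1T))$ a $K$-subalgebra with $A\cap K[[\frac1T]]=K$ and $1\le g:=\dim_KK((\frac1T))/(A+K[[\frac1T]])<\infty$, which is strictly integral. Suppose $\det(\mathbf{e}^{(1)})\in O_K^*$. Then there exists a finite extension $K'$ of $K$ such that, upon replacing $K$ by $K'$, one has $|T_1|=p^g$ and the set $$\{\vec{\pi}=(\pi_1,\ldots,\pi_g)\in T_1 : |\pi_g|=|p|^{1/(p-1)}\}$$ contains at least $p^g-p^{g-1}$ elements.
   Context: $|\cdot|$ is the absolute value on $K$ (extended to finite extensions) with $|p|=1/p$, $O_K=\{|a|\le1\}$, $\mathcal{M}_K=\{|a|<1\}$. $K((\frac1T))$ is the field of series $\sum_{i\le n}v_iT^i$; the degree is the largest exponent with nonzero coefficient. Put $\underline{M}(A)=\{\deg v : 0\ne v\in A\}\subset\mathbb{Z}_{\ge0}$, written $\{s_1<s_2<\cdots\}$; let $\mathbb{Z}_{\ge0}\setminus\underline{M}(A)=\{\mu_1<\cdots<\mu_g\}$. The standard basis of $A$ is the unique basis $v_i=\sum_jv_{ij}T^j$ with $v_i$ monic of degree $s_i$ and $v_{i,s_j}=0$ for $i>j\ge1$; $A$ is strictly integral if all $v_{ij}\in O_K$. Let $O(A)$ be the set of elements of $A$ with all coefficients in $O_K$. One has $O_K[[\frac1T]][T]=O(A)\oplus\frac1TO_K[[\frac1T]]\oplus\bigoplus_{i=1}^gO_KT^{\mu_i}$. For $k\ge0$, $\mathbf{e}^{(k)}=(e^{(k)}_{ij})\in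 M_g(O_K)$ is defined by $T^{\mu_jp^k}-\sum_ie^{(k)}_{ij}T^{\mu_i}\in O(A)\oplus\frac1TO_K[[\frac1T]]$ for $j=1,\dots,g$. Put $\vec{l}(X_1,\ldots,X_g):=\sum_{k\ge0}p^{-k}\mathbf{e}^{(k)}(X_1^{p^k},\ldots,X_g^{p^k})^{t}\in K[[X_1,\ldots,X_g]]^{\oplus g}$ (convergent on $\mathcal{M}_K^{\oplus g}$), and $$T_1:=\{\vec{\pi}\in\mathcal{M}_K^{\oplus g} : \vec{l}(\vec{\pi})=0,\ \max_i|\pi_i|\le|p|^{1/(p-1)}\}.$$ ''Replacing $K$ by $K'$'' means taking $\vec{\pi}\in\mathcal{M}_{K'}^{\oplus g}$ in the definition of $T_1$, with $A$ replaced by its $K'$-span; the matrices $\mathbf{e}^{(k)}$ and the series $\vec{l}$ are unchanged. *)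

(* Defs.v *)
From HB Require Import structures.
From mathcomp Require Import all_boot all_order all_algebra all_field.
From mathcomp Require Import all_classical all_reals all_analysis.

Set Implicit Arguments.
Unset Strict Implicit.
Unset Printing Implicit Defensive.
Import Order.TTheory GRing.Theory Num.Theory.
Import numFieldNormedType.Exports.
Local Open Scope classical_set_scope.
Local Open Scope ring_scope.

Record nonarch_absval (R : realType) (F : fieldType) (abs : F -> R) : Prop :=
  NonarchAbsval {
    absval_ge0 : forall x, 0 <= abs x;
    absval_eq0 : forall x, abs x = 0 <-> x = 0;
    absvalM : forall x y, abs (x * y) = abs x * abs y;
    absvalD : forall x y, abs (x + y) <= Num.max (abs x) (abs y) }.

Definition padic_abs (R : realType) (p : nat) (x : rat) : R :=
  if x == 0 then 0
  else p%:R ^ ((logn p `|denq x|)%:Z - (logn p `|numq x|)%:Z).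

Definition absval_complete (R : realType) (F : fieldType) (abs : F -> R) :=
  forall u : nat -> F,
    (forall eps : R, 0 < eps -> exists N : nat,
       forall m n, (N <= m)%N -> (N <= n)%N -> abs (u m - u n) < eps) ->
    exists l : F, (fun n => abs (u n - l)) @ \oo --> (0 : R).

(* (F, abs) is a completion of the rationals for the p-adic absolute value,
   i.e. Q_p; this determines (F, abs) up to a unique isomorphism. *)
Record is_padic_field (R : realType) (p : nat) (F : fieldType) (abs : F -> R)
  : Prop := IsPadicField {
    padic_nonarch : nonarch_absval abs;
    padic_ratr : forall x : rat, abs (ratr x) = padic_abs R p x;
    padic_dense : forall (x : F) (eps : R), 0 < eps ->
      exists q : rat, abs (x - ratr q) < eps;
    padic_complete : absval_complete abs }.

Record absval_extends (R : realType) (F : fieldType) (L : fieldExtType F)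
    (absF : F -> R) (absL : L -> R) : Prop := AbsvalExtends {
  extends_nonarch : nonarch_absval absL;
  extends_alg : forall a : F, absL a%:A = absF a }.

Section Integers.
Variables (R : realType) (F : fieldType) (abs : F -> R).

Definition integers : set F := [set a | abs a <= 1].

Definition max_ideal : set F := [set a | abs a < 1].

Definition integer_units : set F :=
  [set a | integers a /\ exists2 b, integers b & a * b = 1].

End Integers.

(* A series in the powers of T is given by its coefficient function
   v : int -> F, where v i is the coefficient of T^i; addition and the scaling \*o are
   the pointwise operations on functions. *)
Section Series.
Variable F : fieldType.
Implicit Types (v w : int -> F) (A : set (int -> F)).

Definition laurent : set (int -> F) :=
  [set v | exists n : int, forall i, n < i -> v i = 0].

Definition power_series : set (int -> F) :=
  [set v | forall i : int, 0 < i -> v i = 0].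

Definition Tpow (n : int) : int -> F := fun i => (i == n)%:R.

(* On laurent only finitely many terms of the convolution are nonzero. *)
Definition series_mul v w : int -> F :=
  fun k => \sum_(i \in [set: int]) (v i * w (k - i)).

Record is_subalgebra A : Prop := IsSubalgebra {
  subalg_laurent : A `<=` laurent;
  subalg1 : A (Tpow 0);
  subalgD : forall v w, A v -> A w -> A (v + w);
  subalgZ : forall (c : F) v, A v -> A (c \*o v);
  subalgM : forall v w, A v -> A w -> A (series_mul v w) }.

Definition constants : set (int -> F) := [set c \*o Tpow 0 | c in [set: F]].

Definition sumset A (B : set (int -> F)) : set (int -> F) :=
  [set v + w | v in A & w in B].

Definition quotient_dim (V W : set (int -> F)) (g : nat) : Prop :=
  exists b : 'I_g -> (int -> F),
    [/\ forall i, V (b i),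
        forall v, V v ->
          exists c : 'I_g -> F, W (v - \sum_(i < g) c i \*o b i)
      & forall c : 'I_g -> F, W (\sum_(i < g) c i \*o b i) ->
          forall i, c i = 0].

Definition has_degree v (n : int) : Prop :=
  v n != 0 /\ forall i, n < i -> v i = 0.

Definition degrees A : set nat :=
  [set n | exists2 v, A v & has_degree v n%:Z].

Definition is_basis A (v : nat -> (int -> F)) : Prop :=
  [/\ forall i, A (v i),
      forall (n : nat) (c : 'I_n -> F),
        \sum_(i < n) c i \*o v i = 0 -> forall i, c i = 0
    & forall a, A a ->
        exists (n : nat) (c : 'I_n -> F), a = \sum_(i < n) c i \*o v i].

(* Indices start at 0: s i and v i stand for s_{i+1} and v_{i+1}. *)
Record is_standard_basis A (s : nat -> nat) (v : nat -> (int -> F)) : Prop :=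
  IsStandardBasis {
    std_incr : {homo s : i j / (i < j)%N};
    std_range : range s = degrees A;
    std_basis : is_basis A v;
    std_degree : forall i, has_degree (v i) (s i)%:Z;
    std_monic : forall i, v i (s i)%:Z = 1;
    std_reduced : forall i j, (j < i)%N -> v i (s j)%:Z = 0 }.

Definition gap_enum A (g : nat) (mu : 'I_g -> nat) : Prop :=
  {homo mu : i j / (i < j)%N} /\ range mu = ~` degrees A.

End Series.

Arguments laurent F : clear implicits.
Arguments power_series F : clear implicits.
Arguments constants F : clear implicits.

Section Integrality.
Variables (R : realType) (F : fieldType) (abs : F -> R).
Implicit Type A : set (int -> F).

Definition strictly_integral A : Prop :=
  exists s v, is_standard_basis A s v /\ forall i j, integers abs (v i j).

Definition integral_part A : set (int -> F) :=
  [set v | A v /\ forall i, integers abs (v i)].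

Definition integral_tails : set (int -> F) :=
  [set v | (forall i : int, 0 <= i -> v i = 0) /\
           forall i, integers abs (v i)].

Definition frobenius_matrices A (p g : nat) (mu : 'I_g -> nat)
    (e : nat -> 'M[F]_g) : Prop :=
  forall k j,
    (forall i, integers abs (e k i j)) /\
    sumset (integral_part A) integral_tails
      (Tpow F (mu j * p ^ k)%N%:Z - \sum_(i < g) e k i j \*o Tpow F (mu i)%:Z).

End Integrality.

Section Torsion.
Variables (R : realType) (p g : nat) (F : fieldType) (L : fieldExtType F).
Variables (absL : L -> R) (e : nat -> 'M[F]_g).

Definition l_partial (x : 'cV[L]_g) (n : nat) : 'cV[L]_g :=
  \sum_(k < n) (p%:R ^- k) *:
    (map_mx (in_alg L) (e k) *m map_mx (fun a => a ^+ (p ^ k)) x).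

Definition l_value (x y : 'cV[L]_g) : Prop :=
  forall i, (fun n => absL (l_partial x n i 0 - y i 0)) @ \oo --> (0 : R).

Definition torsion_radius : R := absL p%:R `^ (p%:R - 1)^-1.

Definition T1 : set 'cV[L]_g :=
  [set x : 'cV[L]_g |
     [/\ forall i, max_ideal absL (x i 0),
         l_value x 0
       & \big[Num.max/0]_(i < g) absL (x i 0) <= torsion_radius]].

End Torsion.

Definition last_ord (g : nat) (g_gt0 : (0 < g)%N) : 'I_g :=
  rev_ord (Ordinal g_gt0).

(* Main.v *)
Require Import Defs.
From HB Require Import structures.
From mathcomp Require Import all_boot all_order all_algebra all_fingroup all_solvable all_field.
From mathcomp Require Import all_classical all_reals all_analysis.
From mathcomp Require Import ring zify.

Set Implicit Arguments.
Unset Strict Implicit.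
Unset Printing Implicit Defensive.
Import Order.TTheory GRing.Theory Num.Theory.
Import numFieldNormedType.Exports.
Local Open Scope classical_set_scope.
Local Open Scope card_scope.
Local Open Scope ring_scope.

(* Pick w with w^(p-1) = -p and substitute x = w y: since e^(0) = 1 and
   (p^k - 1)/(p - 1) - k >= k - 1, the equation l(x) = 0 becomes
   y = B y^(p) + (small terms) with B = e^(1), y integral.  Modulo the maximal
   ideal this is the fixed-point equation of the semilinear map y |-> B y^(p).
   The residue field of K being finite, some iterate of that map is y |-> y^(p^n),
   so averaging over the powers of a primitive (p^n - 1)-th root of unity gives a
   matrix U of unit determinant whose columns are fixed modulo the maximal ideal;
   the fixed vectors are then the U z with z in {0, ..., p-1}^g.  Each of them lifts
   to a unique solution by Newton iteration.  The last coordinate has maximal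
   absolute value unless (U z)_g vanishes in the residue field, and U having a unit
   in its last row, that happens for at most p^(g-1) of the z.

   K' is the splitting field of (X^(p-1) + p)(X^(p^n-1) - 1).  The absolute value
   is extended to it by a maximal-subring (Chevalley) argument. *)

Section NonarchBasics.
Variables (R : realType) (F : fieldType) (abs : F -> R).
Hypothesis absP : nonarch_absval abs.

Let ge0 := absval_ge0 absP.
Let M := absvalM absP.
Let D := absvalD absP.

Lemma nabs0 : abs 0 = 0. Proof. by apply/(absval_eq0 absP). Qed.

Lemma nabs_eq0 x : (abs x == 0) = (x == 0).
Proof. by apply/eqP/eqP => /(absval_eq0 absP). Qed.

Lemma nabs_gt0 x : (0 < abs x) = (x != 0).
Proof. by rewrite lt_neqAle eq_sym nabs_eq0 ge0 andbT. Qed.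

Lemma nabs1 : abs 1 = 1.
Proof.
have := M 1 1; rewrite mulr1 => /esym/eqP.
rewrite -subr_eq0 -{3}[abs 1]mulr1 -mulrBr mulf_eq0 nabs_eq0 oner_eq0 /=.
by rewrite subr_eq0 => /eqP.
Qed.

Lemma nabsN x : abs (- x) = abs x.
Proof.
have : abs (-1) ^+ 2 = 1 by rewrite expr2 -M mulrNN mulr1 nabs1.
move=> /eqP; rewrite sqrf_eq1 => /orP[]/eqP h; first by rewrite -mulN1r M h mul1r.
by have := ge0 (-1); rewrite h oppr_ge0 ler10.
Qed.

Lemma nabsC x y : abs (x - y) = abs (y - x).
Proof. by rewrite -nabsN opprB. Qed.

Lemma nabsX x n : abs (x ^+ n) = abs x ^+ n.
Proof. by elim: n => [|n IH]; rewrite ?expr0 ?nabs1 // !exprS M IH. Qed.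

Lemma nabsV x : abs x^-1 = (abs x)^-1.
Proof.
have [->|x0] := eqVneq x 0; first by rewrite !(invr0, nabs0).
by apply: (mulfI (_ : abs x != 0)); rewrite ?nabs_eq0// -M !divff ?nabs1 ?nabs_eq0.
Qed.

Lemma nabsD_le x y c : abs x <= c -> abs y <= c -> abs (x + y) <= c.
Proof. by move=> hx hy; rewrite (le_trans (D x y))// ge_max hx. Qed.

Lemma nabsD_lt x y c : abs x < c -> abs y < c -> abs (x + y) < c.
Proof. by move=> hx hy; rewrite (le_lt_trans (D x y))// gt_max hx. Qed.

Lemma nabsB_le x y c : abs x <= c -> abs y <= c -> abs (x - y) <= c.
Proof. by move=> hx hy; rewrite nabsD_le ?nabsN. Qed.

Lemma nabsB_lt x y c : abs x < c -> abs y < c -> abs (x - y) < c.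
Proof. by move=> hx hy; rewrite nabsD_lt ?nabsN. Qed.

Lemma nabs_dist_le y x z c : abs (x - y) <= c -> abs (y - z) <= c -> abs (x - z) <= c.
Proof. by move=> hx hy; rewrite -(subrKA y) nabsD_le. Qed.

Lemma nabs_dist_lt y x z c : abs (x - y) < c -> abs (y - z) < c -> abs (x - z) < c.
Proof. by move=> hx hy; rewrite -(subrKA y) nabsD_lt. Qed.

Lemma nabs_eq_of_close x y : abs (x - y) < abs y -> abs x = abs y.
Proof.
move=> h; apply/eqP; rewrite eq_le; apply/andP; split.
  by rewrite -(subrK y x) nabsD_le// ltW.
rewrite leNgt; apply/negP => xy.
suff: abs y < abs y by rewrite ltxx.
by rewrite -{1}(subrK x y) nabsD_lt// nabsC.
Qed.

Lemma nabs_sum_le (I : Type) (r : seq I) (P : pred I) (f : I -> F) c :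
  0 <= c -> (forall i, P i -> abs (f i) <= c) -> abs (\sum_(i <- r | P i) f i) <= c.
Proof.
move=> c0 fc; elim/big_rec: _ => [|i x Pi hx]; first by rewrite nabs0.
by rewrite nabsD_le ?fc.
Qed.

Lemma nabs_sum_lt (I : Type) (r : seq I) (P : pred I) (f : I -> F) c :
  0 < c -> (forall i, P i -> abs (f i) < c) -> abs (\sum_(i <- r | P i) f i) < c.
Proof.
move=> c0 fc; elim/big_rec: _ => [|i x Pi hx]; first by rewrite nabs0.
by rewrite nabsD_lt ?fc.
Qed.

Lemma nabs_prod (I : Type) (r : seq I) (P : pred I) (f : I -> F) :
  abs (\prod_(i <- r | P i) f i) = \prod_(i <- r | P i) abs (f i).
Proof. by apply: (big_morph abs); [exact: M | exact: nabs1]. Qed.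

Lemma nabsM_le1 x y : abs x <= 1 -> abs y <= 1 -> abs (x * y) <= 1.
Proof. by move=> hx hy; rewrite M mulr_ile1. Qed.

Lemma nabsM_lt1l x y : abs x < 1 -> abs y <= 1 -> abs (x * y) < 1.
Proof. by move=> hx hy; rewrite M (le_lt_trans _ hx)// ler_piMr. Qed.

Lemma nabsM_lt1r x y : abs x <= 1 -> abs y < 1 -> abs (x * y) < 1.
Proof. by move=> hx hy; rewrite mulrC nabsM_lt1l. Qed.

Lemma nabs_prod_le1 (I : Type) (r : seq I) (P : pred I) (f : I -> F) :
  (forall i, P i -> abs (f i) <= 1) -> abs (\prod_(i <- r | P i) f i) <= 1.
Proof.
move=> fc; elim/big_rec: _ => [|i x Pi hx]; first by rewrite nabs1.
by rewrite nabsM_le1 ?fc.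
Qed.

Lemma nabsX_le1 x n : abs x <= 1 -> abs (x ^+ n) <= 1.
Proof. by move=> hx; rewrite nabsX exprn_ile1. Qed.

Lemma nabsX_lt1 x n : (0 < n)%N -> (abs (x ^+ n) < 1) = (abs x < 1).
Proof. by move=> n0; rewrite nabsX expr_lt1. Qed.

Lemma nabsX_eq1 x n : (0 < n)%N -> abs (x ^+ n) = 1 -> abs x = 1.
Proof. by move=> n0 /eqP; rewrite nabsX pexpr_eq1 // => /eqP. Qed.

Lemma nabs_nat n : abs n%:R <= 1.
Proof. by elim: n => [|n IH]; rewrite ?nabs0 ?ler01// -natr1 nabsD_le ?nabs1. Qed.

Lemma nabs_int m : abs m%:~R <= 1.
Proof. by case: m => n; rewrite ?NegzE ?mulrNz ?nabsN nabs_nat. Qed.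

(* |a - b| < 1 gives a^p - b^p = (a - b) (p b^(p-1) + O(a - b)). *)
Lemma nabs_subX_le n a b : abs a <= 1 -> abs b <= 1 ->
  abs (a ^+ n - b ^+ n) <= abs (a - b) * Num.max (abs n%:R) (abs (a - b)).
Proof.
move=> a1 b1; rewrite subrXX M ler_wpM2l//.
rewrite -[X in abs X](subrK (n%:R * b ^+ n.-1)) nabsD_le//; last first.
  by rewrite M le_max ler_piMr// nabsX_le1.
rewrite le_max; apply/orP; right.
have -> : n%:R * b ^+ n.-1 = \sum_(i < n) (b ^+ (n.-1 - i) * b ^+ i).
  under eq_bigr => i _ do rewrite -exprD subnK ?(ltn_predL, leq_pred) -1?ltnS ?prednK ?(leq_ltn_trans _ (ltn_ord i))//.
  by rewrite sumr_const card_ord mulr_natl.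
rewrite -sumrB nabs_sum_le// => i _; rewrite -mulrBl M.
rewrite (le_trans (ler_piMr (ge0 _) (nabsX_le1 _ b1)))// subrXX M ler_piMr//.
by rewrite nabs_sum_le// => j _; rewrite nabsM_le1// nabsX_le1.
Qed.

Lemma nabs_subX_le1 n a b : abs a <= 1 -> abs b <= 1 ->
  abs (a ^+ n - b ^+ n) <= abs (a - b).
Proof.
move=> a1 b1; rewrite (le_trans (nabs_subX_le n a1 b1))// ler_piMr// ge_max.
by rewrite nabs_nat nabsB_le.
Qed.

Section Frobenius.
Variable p : nat.
Hypotheses (p_pr : prime p) (p_lt1 : abs p%:R < 1).

Lemma nabs_frobD a b : abs a <= 1 -> abs b <= 1 ->
  abs ((a + b) ^+ p - (a ^+ p + b ^+ p)) < 1.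
Proof.
move=> a1 b1; rewrite exprDn.
case: p p_pr p_lt1 => [//|n] n_pr n_lt1.
rewrite big_ord_recl big_ord_recr /= subn0 bin0 subnn binn expr0 mulr1 !mulr1n mul1r.
have reorder (x y z : F) : x + (y + z) - (x + z) = y by ring.
rewrite reorder.
apply: nabs_sum_lt => // i _; rewrite -mulr_natr nabsM_lt1r//.
  by rewrite nabsM_le1// nabsX_le1.
have /dvdnP[c ->] : (n.+1 %| 'C(n.+1, bump 0 i))%N.
  by rewrite prime_dvd_bin// /bump /= add1n ltnS.
by rewrite natrM nabsM_lt1r// nabs_nat.
Qed.

Lemma nabs_frob_sum (I : Type) (r : seq I) (f : I -> F) :
  (forall i, abs (f i) <= 1) ->
  abs ((\sum_(i <- r) f i) ^+ p - \sum_(i <- r) f i ^+ p) < 1.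
Proof.
move=> f1; elim: r => [|i r IH].
  by rewrite !big_nil expr0n gtn_eqF ?prime_gt0// subr0 nabs0.
rewrite !big_cons.
apply: (@nabs_dist_lt (f i ^+ p + (\sum_(j <- r) f j) ^+ p)).
  by apply: nabs_frobD => //; apply: nabs_sum_le.
by rewrite opprD addrACA subrr add0r.
Qed.

Lemma nabs_frobB_lt a b : abs a <= 1 -> abs b <= 1 ->
  abs (a ^+ p - b ^+ p) < 1 -> abs (a - b) < 1.
Proof.
move=> a1 b1 h; rewrite -(nabsX_lt1 _ (prime_gt0 p_pr)).
have ab1 : abs (a - b) <= 1 by rewrite nabsB_le.
have := nabs_frobD ab1 b1; rewrite subrK => h2.
have -> : (a - b) ^+ p = (a ^+ p - b ^+ p) - (a ^+ p - ((a - b) ^+ p + b ^+ p)) by ring.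
exact: nabsB_lt.
Qed.

Lemma nabs_eqmod m n : (m = n %[mod p])%N -> abs (m%:R - n%:R) < 1.
Proof.
move=> mn; have red k : k%:R = (k %/ p)%:R * p%:R + (k %% p)%:R :> F.
  by rewrite -natrM -natrD -divn_eq.
rewrite (red m) (red n) mn opprD addrACA subrr addr0 -mulrBl.
by rewrite nabsM_lt1r// nabsB_le ?nabs_nat.
Qed.

Lemma nabs_nat_fermat n : abs (n%:R ^+ p - n%:R) < 1.
Proof. by rewrite -natrX; apply/nabs_eqmod/fermat_little. Qed.

Lemma nabs_nat_unit n : ~~ (p %| n)%N -> abs n%:R = 1.
Proof.
move=> ndv; have cop : coprime n p by rewrite coprime_sym prime_coprime.
apply: (@nabsX_eq1 _ (totient p)); first by rewrite totient_gt0 prime_gt0.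
have := nabs_eqmod (Euler_exp_totient cop).
by rewrite natrX -[X in _ < X]nabs1 => /nabs_eq_of_close ->; rewrite nabs1.
Qed.

Lemma nabs_nat_sub_lt m n : (m < p)%N -> (n < p)%N ->
  abs (m%:R - n%:R) < 1 -> m = n.
Proof.
wlog le_mn : m n / (m <= n)%N.
  move=> H mp np h; have [mn|/ltnW nm] := leqP m n; first exact: H.
  by rewrite nabsC in h; rewrite (H n m).
move=> mp np; rewrite nabsC -natrB// => h; apply/eqP; rewrite eqn_leq le_mn /=.
rewrite leqNgt; apply/negP => lt_mn; move: h; rewrite nabs_nat_unit ?ltxx//.
by rewrite gtnNdvd ?subn_gt0// (leq_ltn_trans (leq_subr _ _)).
Qed.

Lemma Fp_prod_XsubC (q : nat) (q_pr : prime q) :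
  'X^q - 'X = \prod_(0 <= a < q) ('X - (a%:R)%:P) :> {poly 'F_q}.
Proof.
pose rs := [seq a%:R : 'F_q | a <- iota 0 q].
have szf : size ('X^q - 'X : {poly 'F_q}) = q.+1.
  by rewrite size_polyDl size_polyXn// size_polyN size_polyX ltnS prime_gt1.
have lf : lead_coef ('X^q - 'X : {poly 'F_q}) = 1.
  by rewrite lead_coefDl ?lead_coefXn// size_polyN size_polyX size_polyXn ltnS prime_gt1.
have := @all_roots_prod_XsubC _ ('X^q - 'X : {poly 'F_q}) rs.
rewrite szf lf scale1r size_map size_iota => -> //.
- by rewrite big_map /index_iota subn0.
- apply/allP => _ /mapP[a _ ->]; rewrite rootE !hornerE subr_eq0.
  by have := expf_card (a%:R : 'F_q); rewrite card_Fp// => ->.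
- rewrite uniq_rootsE map_inj_in_uniq ?iota_uniq// => a b.
  rewrite !mem_iota !add0n /= => aq bq /(congr1 (@nat_of_ord _)).
  by rewrite !val_Fp_nat// !modn_small.
Qed.

Lemma nabs_fixed_frob w : abs w <= 1 -> abs (w ^+ p - w) < 1 ->
  exists a : 'I_p, abs (w - a%:R) < 1.
Proof.
move=> w1 ww; apply/not_existsP => far.
pose Q : {poly int} := 'X^p - 'X - \prod_(0 <= a < p) ('X - (a%:R)%:P).
have Qp i : exists c : int, Q`_i = c * p%:Z.
  have : map_poly (intr : int -> 'F_p) Q = 0.
    rewrite !rmorphB /= map_polyXn map_polyX rmorph_prod /= Fp_prod_XsubC//.
    apply/eqP; rewrite subr_eq0; apply/eqP; apply: eq_bigr => a _.
    by rewrite rmorphB /= map_polyX map_polyC /= natz -pmulrn.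
  move/(congr1 (fun q : {poly 'F_p} => q`_i)); rewrite coef0 coef_map /= => /eqP.
  rewrite -(dvdz_pcharf (pchar_Fp p_pr)) => /dvdzP[c ->]; by exists c.
have small : abs (map_poly (intr : int -> F) Q).[w] < 1.
  rewrite horner_coef nabs_sum_lt// => i _; rewrite nabsM_lt1l ?nabsX_le1//.
  rewrite coef_map /=; have [c ->] := Qp i.
  by rewrite intrM nabsM_lt1r ?nabs_int.
have : abs (\prod_(0 <= a < p) (w - a%:R)) < 1.
  move: small; rewrite !rmorphB /= map_polyXn map_polyX rmorph_prod /=.
  rewrite !hornerE horner_prod => small.
  rewrite -(subKr (w ^+ p - w) (\prod_(0 <= a < p) (w - a%:R))) nabsB_lt//.
  move: small; congr (abs (_ - _) < 1); apply: eq_bigr => a _.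
  by rewrite rmorphB /= map_polyX map_polyC /= natz -pmulrn !hornerE.
rewrite nabs_prod big_nat big1 ?ltxx// => a /andP[_ ap].
apply/eqP; rewrite eq_le nabsB_le ?nabs_nat//= leNgt; apply/negP.
exact: (far (Ordinal ap)).
Qed.

End Frobenius.
End NonarchBasics.

Section Limits.
Variables (R : realType) (F : fieldType) (abs : F -> R).
Hypothesis absP : nonarch_absval abs.

Lemma cvg0P (f : nat -> R) : (forall n, 0 <= f n) ->
  f @ \oo --> (0 : R) <->
  forall eps, 0 < eps -> exists N, forall n, (N <= n)%N -> f n < eps.
Proof.
move=> f0; split=> [/cvgrPdist_lt h eps /h[N _ hN]|h].
  exists N => n /hN /=; by rewrite sub0r normrN ger0_norm.
apply/cvgrPdist_lt => eps /h[N hN]; exists N => // n /= /hN.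
by rewrite sub0r normrN ger0_norm.
Qed.

Definition lim_to (u : nat -> F) (l : F) :=
  forall eps, 0 < eps -> exists N, forall n, (N <= n)%N -> abs (u n - l) < eps.

Definition cauchy (u : nat -> F) :=
  forall eps, 0 < eps -> exists N, forall m n, (N <= m)%N -> (N <= n)%N ->
    abs (u m - u n) < eps.

Lemma lim_toP u l : (fun n => abs (u n - l)) @ \oo --> (0 : R) <-> lim_to u l.
Proof. by apply: cvg0P => n; exact: absval_ge0 absP _. Qed.

Lemma completeP : absval_complete abs <-> forall u, cauchy u -> exists l, lim_to u l.
Proof.
by split=> h u /h[l /lim_toP ul]; exists l.
Qed.

Lemma lim_to_cauchy u l : lim_to u l -> cauchy u.
Proof.
move=> ul eps /ul[N hN]; exists N => m n /hN hm /hN hn.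
by apply: (nabs_dist_lt absP hm); rewrite nabsC.
Qed.

Lemma lim_to_unique u l l' : lim_to u l -> lim_to u l' -> l = l'.
Proof.
move=> ul ul'; apply/eqP; rewrite -subr_eq0 -(nabs_eq0 absP); apply/negPn/negP => h.
have e0 : 0 < abs (l - l') by rewrite lt_neqAle eq_sym h (absval_ge0 absP).
have [N hN] := ul _ e0; have [N' hN'] := ul' _ e0.
suff : abs (l - l') < abs (l - l') by rewrite ltxx.
apply: (nabs_dist_lt absP (y := u (maxn N N'))).
  by rewrite nabsC// hN// leq_maxl.
by rewrite hN'// leq_maxr.
Qed.

(* By the ultrametric inequality consecutive differences suffice. *)
Lemma cauchy_succ u :
  (forall eps, 0 < eps -> exists N, forall n, (N <= n)%N -> abs (u n.+1 - u n) < eps) ->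
  cauchy u.
Proof.
move=> h eps e0; have [N hN] := h _ e0; exists N.
have base k : abs (u (N + k)%N - u N) < eps.
  elim: k => [|k IH]; first by rewrite addn0 subrr nabs0.
  by apply: (nabs_dist_lt absP (y := u (N + k)%N)) => //; rewrite addnS hN// leq_addr.
move=> m n /subnKC <- /subnKC <-; apply: (nabs_dist_lt absP (base _)).
by rewrite nabsC.
Qed.

End Limits.

Section FiniteExtension.
Variables (R : realType) (F : fieldType) (L : fieldExtType F).
Variables (absF : F -> R) (absL : L -> R).
Hypotheses (absF_ext : absval_extends absF absL) (F_complete : absval_complete absF)
  (absFP : nonarch_absval absF).

Let absP : nonarch_absval absL := extends_nonarch absF_ext.

Lemma nabsZ a x : absL (a *: x) = absF a * absL x.
Proof. by rewrite -mulr_algl (absvalM absP) (extends_alg absF_ext). Qed.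

Lemma span_complete (X : seq L) (u : nat -> L) :
  (forall n, u n \in <<X>>%VS) -> cauchy absL u ->
  exists2 l, l \in <<X>>%VS & lim_to absL u l.
Proof.
elim: X u => [|b X IH] u uX cu.
  exists 0; first exact: mem0v.
  move=> eps e0; exists 0%N => n _; move: (uX n).
  by rewrite span_nil memv0 => /eqP ->; rewrite subrr (nabs0 absP).
have [bX|bX] := boolP (b \in <<X>>%VS).
  have e : <<b :: X>>%VS = <<X>>%VS.
    by rewrite span_cons; apply/addv_idPr; rewrite -memvE.
  by rewrite e; apply: IH => // n; rewrite -e.
have [d d0 hd] : exists2 d : R, 0 < d & forall w, w \in <<X>>%VS -> d <= absL (b - w).
  apply: contrapT => /forall2NP far.
  have near n : exists w, w \in <<X>>%VS /\ absL (b - w) < n.+1%:R^-1.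
    have [|/existsNP[w /not_implyP[wX /negP]]] := far n.+1%:R^-1.
      by case; rewrite invr_gt0.
    by rewrite -ltNge => hw; exists w.
  have [w hw] := choice near.
  have wb : lim_to absL w b.
    move=> eps e0; exists (Num.truncn eps^-1) => n hn.
    rewrite nabsC//; apply: (lt_le_trans (hw n).2).
    rewrite invf_ple ?posrE// ltW// (lt_le_trans (truncnS_gt _))// ler_nat ltnS//.
  have [l lX wl] := IH w (fun n => (hw n).1) (lim_to_cauchy absP wb).
  by rewrite (lim_to_unique absP wb wl) lX in bX.
have dec n : exists ww, [/\ ww.2 \in <<X>>%VS & u n = ww.1 *: b + ww.2].
  have := uX n; rewrite span_cons => /memv_addP[c /vlineP[k ->] [w wX ->]].
  by exists (k, w).
have [aw haw] := choice dec.
pose a n := (aw n).1; pose w n := (aw n).2.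
have uE n : u n = a n *: b + w n by have [_ ->] := haw n.
have wX n : w n \in <<X>>%VS by have [] := haw n.
have da m n : absF (a m - a n) * d <= absL (u m - u n).
  have [amn|amn] := eqVneq (a m - a n) 0.
    by rewrite amn (nabs0 absFP) mul0r (absval_ge0 absP).
  have -> : u m - u n = (a m - a n) *: (b - (a m - a n)^-1 *: (w n - w m)).
    rewrite scalerBr scalerA divff// scale1r scalerBl !uE; ring.
  rewrite nabsZ ler_wpM2l ?(absval_ge0 absFP)// hd// memvZ// memvB//.
have ca : cauchy absF a.
  move=> eps e0; have [N hN] := cu (eps * d) (mulr_gt0 e0 d0).
  exists N => m n hm hn; rewrite -(ltr_pM2r d0).
  exact: le_lt_trans (da m n) (hN m n hm hn).
have [al hal] := (completeP absFP).1 F_complete a ca.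
have lab : lim_to absL (fun n => a n *: b) (al *: b).
  move=> eps e0.
  have b0 : 0 < absL b by rewrite nabs_gt0//; apply: contraNneq bX => ->; exact: mem0v.
  have [N hN] := hal (eps / absL b) (divr_gt0 e0 b0).
  by exists N => n hn; rewrite -scalerBl nabsZ -ltr_pdivlMr// hN.
have cw : cauchy absL w.
  move=> eps e0; have [N hN] := cu _ e0.
  have [N' hN'] := lim_to_cauchy absP lab e0.
  exists (maxn N N') => m n; rewrite !geq_max => /andP[m1 m2] /andP[n1 n2].
  have -> : w m - w n = (u m - u n) - (a m *: b - a n *: b) by rewrite !uE; ring.
  by rewrite nabsB_lt ?hN ?hN'.
have [wl wlX hwl] := IH w wX cw.
exists (al *: b + wl).
  by rewrite span_cons memv_add// memvZ// memv_line.
move=> eps e0; have [N hN] := lab _ e0; have [N' hN'] := hwl _ e0.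
exists (maxn N N') => n; rewrite geq_max => /andP[n1 n2].
have -> : u n - (al *: b + wl) = (a n *: b - al *: b) + (w n - wl) by rewrite uE; ring.
by rewrite nabsD_lt ?hN ?hN'.
Qed.

Lemma extension_complete : absval_complete absL.
Proof.
apply/(completeP absP) => u cu.
have uX n : u n \in <<vbasis {:L}>>%VS by rewrite (span_basis (vbasisP _)) memvf.
by have [l _ ul] := span_complete uX cu; exists l.
Qed.

End FiniteExtension.

Lemma exists_expn_lt (R : realType) (c eps : R) : 0 <= c < 1 -> 0 < eps ->
  exists N, forall n, (N <= n)%N -> c ^+ n < eps.
Proof.
move=> /andP[c0 c1] e0.
have /cvgrPdist_lt /(_ _ e0)[N _ hN] : (fun n => c ^+ n) @ \oo --> (0 : R).
  by apply: cvg_expr; rewrite ger0_norm.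
by exists N => n /hN /=; rewrite sub0r normrN ger0_norm// exprn_ge0.
Qed.

Lemma powR_natV (R : realType) (c : R) n : (0 < n)%N -> 0 <= c -> (c `^ n%:R^-1) ^+ n = c.
Proof.
move=> n0 c0; rewrite -powR_mulrn ?powR_ge0// -powRrM mulVf ?pnatr_eq0 -?lt0n//.
by rewrite powRr1.
Qed.

Lemma powR_Xn (R : realType) (c : R) n : (0 < n)%N -> 0 <= c -> (c ^+ n) `^ n%:R^-1 = c.
Proof.
move=> n0 c0; rewrite -powR_mulrn// -powRrM mulfV ?pnatr_eq0 -?lt0n//.
by rewrite powRr1.
Qed.

Lemma dense_powR (R : realType) (c s1 s2 : R) : 0 < c < 1 -> 0 < s1 -> s1 < s2 ->
  exists (m : int) (n : nat), (0 < n)%N /\ s1 < (c ^ m) `^ n%:R^-1 < s2.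
Proof.
move=> /andP[c0 c1] s10 s12; have lc : ln c < 0 by apply: ln_lt0; rewrite c0.
have s20 := lt_trans s10 s12.
have : ln s2 / ln c < ln s1 / ln c by rewrite ltr_nM2r ?invr_lt0// ltr_ln.
move=> /rat_in_itvoo[q]; rewrite in_itv => /andP[/= q1 q2].
exists (numq q), `|denq q|%N; split; first by rewrite absz_gt0 denq_neq0.
have -> : (c ^ numq q) `^ `|denq q|%:R^-1 = expR (ratr q * ln c).
  rewrite -(powR_intmul _ (ltW c0)) -powRrM /powR (gt_eqF c0).
  have -> : `|denq q|%:R = (denq q)%:~R :> R.
    by rewrite -[in RHS](gez0_abs (ltW (denq_gt0 q))) pmulrn.
  by [].
have [e1 e2] : s1 = expR (ln s1) /\ s2 = expR (ln s2) by rewrite !lnK.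
rewrite e1 e2 !ltr_expR; apply/andP; split.
  by rewrite -ltr_ndivlMr.
by rewrite -ltr_ndivrMr.
Qed.

Section ChevalleyExtension.
Variables (R : realType) (F : fieldType) (L : fieldExtType F) (absF : F -> R).
Variable t : F.
Hypotheses (absP : nonarch_absval absF) (t0 : t != 0) (t1 : absF t < 1).

Record subring_over (B : set L) : Prop := SubringOver {
  over_int : forall a, absF a <= 1 -> B a%:A;
  overB : forall x y, B x -> B y -> B (x - y);
  overM : forall x y, B x -> B y -> B (x * y);
  over_t : ~ B (t^-1)%:A }.

Lemma in_alg_inj (a b : F) : a%:A = b%:A :> L -> a = b.
Proof. exact: (fmorph_inj (in_alg L)). Qed.

Lemma in_algM (a b : F) : (a * b)%:A = a%:A * b%:A :> L.
Proof. exact: (rmorphM (in_alg L)). Qed.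

Lemma in_algV (a : F) : (a^-1)%:A = (a%:A)^-1 :> L.
Proof. exact: (fmorphV (in_alg L)). Qed.

Lemma in_algX (a : F) n : (a ^+ n)%:A = a%:A ^+ n :> L.
Proof. exact: (rmorphXn (in_alg L)). Qed.

Lemma tA0 : t%:A != 0 :> L.
Proof. by rewrite -(scale0r 1); apply: contra_neq t0 => /in_alg_inj. Qed.

Lemma absV_t_gt1 : 1 < absF t^-1.
Proof. by rewrite (nabsV absP) invf_gt1// (nabs_gt0 absP). Qed.

Lemma max_subring : exists2 B, subring_over B &
  forall C, subring_over C -> B `<=` C -> C `<=` B.
Proof.
pose O : set L := [set a%:A | a in [set a | absF a <= 1]].
have Ogood : subring_over O.
  split=> [a a1|_ _ [a a1 <-] [b b1 <-]|_ _ [a a1 <-] [b b1 <-]|[a a1 /in_alg_inj e]].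
  - by exists a.
  - by exists (a - b); rewrite ?scalerBl//=; apply: nabsB_le.
  - by exists (a * b); rewrite ?in_algM//=; apply: nabsM_le1.
  - by move: a1; rewrite /= e leNgt absV_t_gt1.
have [|B [PB maxB]] := @Zorn_bigcup L (fun B => B = set0 \/ subring_over B).
  move=> G GP totG.
  have [[X0 GX0 X0good]|none] := pselect (exists2 X, G X & subring_over X); last first.
    left; rewrite predeqE => x; split=> // -[X GX Xx].
    by have [X0|Xg] := GP _ GX; [rewrite X0 in Xx | case: none; exists X].
  have memG x y : (\bigcup_(X in G) X) x -> (\bigcup_(X in G) X) y ->
      exists X, [/\ G X, subring_over X, X x & X y].
    move=> [X GX Xx] [Y GY Yy].
    have [Xg Yg] : subring_over X /\ subring_over Y.
      have [X0'|?] := GP _ GX; first by rewrite X0' in Xx.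
      by have [Y0|?] := GP _ GY; first by rewrite Y0 in Yy.
    by have [/(_ x Xx)|/(_ y Yy)] := totG _ _ GX GY; [exists Y | exists X].
  right; split=> [a a1|x y Gx Gy|x y Gx Gy|[X GX Xt]].
  - by exists X0 => //; apply: over_int.
  - by have [X [GX Xg Xx Xy]] := memG _ _ Gx Gy; exists X => //; apply: overB.
  - by have [X [GX Xg Xx Xy]] := memG _ _ Gx Gy; exists X => //; apply: overM.
  - by have [X0'|/over_t] := GP _ GX; [rewrite X0' in Xt | exact].
case: PB => [B0|Bgood].
  exfalso; apply: (maxB O); last by right.
  rewrite B0; split=> // /(_ (1%:A)); case; apply: (over_int Ogood).
  by rewrite (nabs1 absP).
exists B => // C Cgood BC x Cx; apply: contrapT => nBx.
by apply: (maxB C); [split=> // /(_ x Cx) | right].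
Qed.

Section MaximalSubring.
Variable B : set L.
Hypotheses (Bgood : subring_over B)
  (Bmax : forall C, subring_over C -> B `<=` C -> C `<=` B).

Let B1 : B 1.
Proof. by rewrite -(scale1r 1); apply: (over_int Bgood); rewrite (nabs1 absP). Qed.

Let B0 : B 0. Proof. by rewrite -(subrr 1); apply: overB. Qed.

Let BN x : B x -> B (- x). Proof. by rewrite -(sub0r x); apply: overB. Qed.

Let BD x y : B x -> B y -> B (x + y).
Proof. by move=> Bx By; rewrite -(opprK y); apply: overB => //; apply: BN. Qed.

Let BM x y : B x -> B y -> B (x * y). Proof. exact: overM. Qed.

Let BX x n : B x -> B (x ^+ n).
Proof. by move=> Bx; elim: n => [|n IH]; rewrite ?expr0// exprS; apply: BM. Qed.

Let Bsum (I : Type) (r : seq I) (P : pred I) (f : I -> L) :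
  (forall i, P i -> B (f i)) -> B (\sum_(i <- r | P i) f i).
Proof.
by move=> h; elim/big_rec: _ => [|i x Pi hx]; [exact: B0 | apply: BD => //; apply: h].
Qed.

Let Bt : B t%:A. Proof. by apply: (over_int Bgood); exact: ltW. Qed.

Lemma not_mem_adjoin x : ~ B x ->
  exists2 q : {poly L}, forall i, B q`_i & q.[x] = (t^-1)%:A.
Proof.
move=> nBx; apply: contrapT => /forall2NP nq.
pose C : set L := [set y | exists2 q : {poly L}, forall i, B q`_i & q.[x] = y].
have BC : B `<=` C.
  move=> y By; exists y%:P; last by rewrite hornerC.
  by move=> i; rewrite coefC; case: ifP.
have Cx : C x.
  exists 'X; last by rewrite hornerX.
  by move=> i; rewrite coefX; case: (_ == _).
apply: nBx; apply: (@Bmax C _ BC) => //; split.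
- by move=> a a1; apply: BC; apply: over_int.
- move=> _ _ [q Bq <-] [r Br <-]; exists (q - r); last by rewrite hornerD hornerN.
  by move=> i; rewrite coefB; apply: overB.
- move=> _ _ [q Bq <-] [r Br <-]; exists (q * r); last by rewrite hornerM.
  by move=> i; rewrite coefM; apply: Bsum => j _; apply: BM.
- by move=> [q Bq e]; have [] := nq q.
Qed.

Lemma unit_1t b : B b -> B (1 - t%:A * b)^-1.
Proof.
move=> Bb; set u := 1 - _; apply: contrapT => /not_mem_adjoin[q Bq qu].
have u0 : u != 0.
  apply/eqP => /eqP; rewrite subr_eq0 => /eqP e; apply: (over_t Bgood).
  rewrite in_algV (_ : _^-1 = b)//.
  by apply: (mulfI tA0); rewrite divff ?tA0//; apply/esym.
have Bu : B u by rewrite /u; apply: (overB Bgood) => //; exact: BM.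
have un n : exists2 b', B b' & u ^+ n = 1 - t%:A * b'.
  elim: n => [|n [b' Bb' e]]; first by exists 0; rewrite // mulr0 subr0.
  exists (b' + b - t%:A * (b * b')).
    by apply: (overB Bgood); [exact: BD | apply: BM => //; exact: BM].
  by rewrite exprS e /u; ring.
have [b' Bb' e] := un (size q).
have : B ((t^-1)%:A * u ^+ size q).
  rewrite -qu horner_coef mulr_suml; apply: Bsum => i _.
  rewrite -mulrA; apply: BM => //.
  by rewrite exprVn mulrC -expfB ?ltn_ord//; apply: BX.
rewrite e mulrBr mulr1 mulrA in_algV mulVf ?tA0// mul1r -in_algV => h.
by apply: (over_t Bgood); rewrite -(subrK b' (t^-1)%:A); apply: BD.
Qed.

(* 1 - t r_0 being a unit of B, the relation given by r expresses the leading power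
   of x in q through lower ones. *)
Lemma adjoin_reduce x (q r : {poly L}) : x != 0 ->
  (forall i, B q`_i) -> (forall i, B r`_i) ->
  q.[x] = (t^-1)%:A -> r.[x^-1] = (t^-1)%:A -> (size r <= size q)%N ->
  exists q' : {poly L}, [/\ forall i, B q'`_i, q'.[x] = (t^-1)%:A & (size q' < size q)%N].
Proof.
move=> x0 Bq Br qx rx rq.
have tV0 : (t^-1)%:A != 0 :> L by rewrite in_algV invr_eq0 tA0.
have sq0 : (0 < size q)%N.
  by rewrite size_poly_gt0; apply: contraNneq tV0 => q0; rewrite -qx q0 horner0.
pose n := (size q).-1; have sq : size q = n.+1 by rewrite prednK.
pose v := (1 - t%:A * r`_0)^-1.
exists (\poly_(j < n) (q`_j + q`_n * v * t%:A * r`_(n - j))); split.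
- move=> i; rewrite coef_poly; case: ifP => _ //; apply: BD => //.
  by do ![apply: BM => //]; exact: unit_1t.
- rewrite horner_poly; under eq_bigr do rewrite mulrDl.
  rewrite big_split /=.
  have u0 : 1 - t%:A * r`_0 != 0.
    apply/eqP => /eqP; rewrite subr_eq0 => /eqP e; apply: (over_t Bgood).
    rewrite in_algV (_ : _^-1 = r`_0)//.
    by apply: (mulfI tA0); rewrite divff ?tA0//; apply/esym.
  have -> : \sum_(i < n) q`_n * v * t%:A * r`_(n - i) * x ^+ i = q`_n * x ^+ n.
    have rE : \sum_(i < n) r`_(n - i) * x ^+ i = x ^+ n * ((t^-1)%:A - r`_0).
      have rn : (size r <= n.+1)%N by rewrite -sq.
      rewrite -rx (horner_coef_wide _ rn) big_ord_recl expr0 mulr1.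
      rewrite [r`_0 + _]addrC addrK mulr_sumr (reindex_inj rev_ord_inj) /=.
      apply: eq_bigr => i _; rewrite subKn ?ltn_ord// /bump /= add1n mulrCA.
      by rewrite exprVn -expfB_cond ?(negPf x0) ?add0n ?ltn_ord.
    under eq_bigr do rewrite -mulrA; rewrite -mulr_sumr rE.
    have -> : q`_n * v * t%:A * (x ^+ n * ((t^-1)%:A - r`_0)) =
      q`_n * x ^+ n * (v * (t%:A * (t^-1)%:A - t%:A * r`_0)) by ring.
    by rewrite in_algV divff ?tA0// /v mulVf// mulr1.
  by rewrite -qx horner_coef sq big_ord_recr.
- by rewrite [X in (_ < X)%N]sq ltnS size_poly.
Qed.

Lemma max_subring_val x : B x \/ B x^-1.
Proof.
have [->|x0] := eqVneq x 0; first by left.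
apply: contrapT => /not_orP[/not_mem_adjoin[q Bq qx] /not_mem_adjoin[r Br rx]].
have [n] := ubnP (size q + size r); elim: n => // n IH in x x0 q r Bq Br qx rx *.
rewrite ltnS => qrn.
wlog rq : x x0 q r Bq Br qx rx qrn / (size r <= size q)%N.
  move=> H; have [rq|/ltnW qr] := leqP (size r) (size q); first exact: (H x x0 q r).
  by apply: (H x^-1 _ r q) => //; rewrite ?invr_eq0 ?invrK 1?addnC.
have [q' [Bq' q'x q's]] := adjoin_reduce x0 Bq Br qx rx rq.
by apply: (IH x x0 q' r) => //; rewrite (leq_trans _ qrn)// ltn_add2r.
Qed.

Lemma abs_t_itv : 0 <= absF t < 1.
Proof. by rewrite t1 (absval_ge0 absP). Qed.

Lemma exists_absX_le1 a : exists N, forall n, (N <= n)%N -> absF (t ^+ n * a) <= 1.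
Proof.
have [->|a0] := eqVneq a 0.
  by exists 0%N => n _; rewrite mulr0 (nabs0 absP) ler01.
have ai0 : 0 < (absF a)^-1 by rewrite invr_gt0 (nabs_gt0 absP).
have [N hN] := exists_expn_lt abs_t_itv ai0.
exists N => n /hN h; rewrite (absvalM absP) (nabsX absP).
by rewrite -ler_pdivlMr ?(nabs_gt0 absP)// div1r ltW.
Qed.

Lemma max_subring_int a : B a%:A -> absF a <= 1.
Proof.
move=> Ba; rewrite leNgt; apply/negP => a1.
have a0 : a != 0 by rewrite -(nabs_gt0 absP) (lt_trans ltr01).
have itv : 0 <= (absF a)^-1 < 1 by rewrite invr_ge0 (absval_ge0 absP) invf_lt1// (lt_trans ltr01).
have e0 : 0 < absF t by rewrite (nabs_gt0 absP).
have [N /(_ N (leqnn N)) hN] := exists_expn_lt itv e0.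
apply: (over_t Bgood).
have -> : (t^-1)%:A = a%:A ^+ N * (a ^- N * t^-1)%:A :> L.
  by rewrite -in_algX -in_algM mulrA divff ?expf_neq0// mul1r.
apply: BM; first exact: BX.
apply: (over_int Bgood); rewrite (absvalM absP) !(nabsV absP) (nabsX absP).
by rewrite ler_pdivrMr ?mul1r// -exprVn ltW.
Qed.

Lemma max_subring_arch x : exists N, B ((t ^+ N)%:A * x).
Proof.
pose f := minPoly 1%AS x; pose d := (size f).-1.
have fmon : f \is monic := monic_minPoly _ _.
have sf : size f = d.+1 by rewrite prednK// size_poly_gt0 monic_neq0.
have fa i : exists a : F, f`_i = a%:A.
  by have /polyOverP/(_ i)/vlineP := minPolyOver 1%AS x.
have [a fE] := choice fa.
have [N hN] : exists N, forall i, (i < d)%N -> absF (t ^+ N * a i) <= 1.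
  elim: d {sf} => [|k [N hN]]; first by exists 0%N.
  have [N' hN'] := exists_absX_le1 (a k).
  have [N'' hN''] : exists N'', forall n, (N'' <= n)%N -> forall i, (i < k)%N -> absF (t ^+ n * a i) <= 1.
    exists N => n /subnK <- i /hN h; rewrite exprD -mulrA; apply: (nabsM_le1 absP) => //.
    by apply: (nabsX_le1 absP); exact: ltW.
  exists (maxn N' N'') => i; rewrite ltnS leq_eqVlt => /orP[/eqP ->|ik].
    by apply: hN'; exact: leq_maxl.
  by apply: hN'' => //; exact: leq_maxr.
exists N; set z := _ * x.
have [//|Bw] := max_subring_val z.
have [z0|z0] := eqVneq z 0; first by rewrite z0.
have xd : x ^+ d = - \sum_(i < d) f`_i * x ^+ i.
  have : f.[x] = 0 by apply/rootP; exact: root_minPoly.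
  rewrite horner_coef sf big_ord_recr /=.
  have -> : f`_d = 1 by have /monicP := fmon; rewrite lead_coefE.
  by rewrite mul1r addrC => /eqP; rewrite addr_eq0 => /eqP.
have d0 : (0 < d)%N.
  rewrite lt0n; apply: contra_eq_neq xd => ->.
  by rewrite expr0 big_ord0 oppr0 oner_eq0.
have -> : z = - \sum_(i < d) (t ^+ (N * (d - i)) * a i)%:A * z^-1 ^+ (d - i.+1).
  apply: (mulIf (expf_neq0 d.-1 z0)).
  rewrite -exprS prednK// /z exprMn xd mulrN mulNr; congr (- _).
  rewrite mulr_sumr mulr_suml; apply: eq_bigr => i _.
  have dE : (d - i.+1 + i = d.-1)%N by have := ltn_ord i; lia.
  rewrite -[d.-1]dE -mulrA exprD [z^-1 ^+ _ * _]mulrA -exprMn mulVf// expr1n mul1r.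
  rewrite /z exprMn mulrA mulrCA mulrA fE; congr (_ * _).
  rewrite -{1}(subnK (ltnW (ltn_ord i))) exprM exprD -!in_algX -!in_algM.
  by rewrite -mulrA mulrCA.
apply: BN; apply: Bsum => i _; apply: BM; last exact: BX.
apply: (over_int Bgood); rewrite -(@subnKC 1 (d - i)) ?subn_gt0//.
rewrite mulnDr muln1 addnC exprD -mulrA; apply: (nabsM_le1 absP); last exact: hN.
by apply: (nabsX_le1 absP); exact: ltW.
Qed.

Let dvB x y := exists2 z, B z & x = y * z.

Let dvB_trans y x z : dvB x y -> dvB y z -> dvB x z.
Proof. by move=> [u Bu ->] [v Bv ->]; exists (v * u); rewrite ?mulrA//; apply: BM. Qed.

Let dvBM x y x' y' : dvB x y -> dvB x' y' -> dvB (x * x') (y * y').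
Proof. by move=> [u Bu ->] [v Bv ->]; exists (u * v); [exact: BM | ring]. Qed.

Let dvBX x y n : dvB x y -> dvB (x ^+ n) (y ^+ n).
Proof. by move=> [u Bu ->]; exists (u ^+ n); [exact: BX | rewrite exprMn]. Qed.

Let dvB_total x y : dvB x y \/ dvB y x.
Proof.
have [->|x0] := eqVneq x 0; first by left; exists 0; rewrite ?mulr0.
have [->|y0] := eqVneq y 0; first by right; exists 0; rewrite ?mulr0.
have [Bz|Bz] := max_subring_val (y / x).
  by right; exists (y / x) => //; rewrite mulrC divfK.
by left; exists (x / y); [rewrite -invf_div | rewrite mulrC divfK].
Qed.

Let dvB_alg a b : dvB a%:A b%:A <-> absF a <= absF b.
Proof.
have [->|b0] := eqVneq b 0.
  rewrite (nabs0 absP); split=> [[z _]|a0].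
    by rewrite scale0r mul0r -(scale0r 1) => /in_alg_inj ->; rewrite (nabs0 absP).
  have /eqP : absF a = 0 by apply/eqP; rewrite eq_le a0 (absval_ge0 absP).
  by rewrite (nabs_eq0 absP) => /eqP ->; exists 0; rewrite // !scale0r mul0r.
have bA0 : b%:A != 0 :> L by rewrite -(scale0r 1); apply: contra_neq b0 => /in_alg_inj.
have bp : 0 < absF b by rewrite (nabs_gt0 absP).
split=> [[z Bz e]|ab].
  have : B (a / b)%:A by rewrite in_algM in_algV e mulrAC divff// mul1r.
  by move=> /max_subring_int; rewrite (absvalM absP) (nabsV absP) ler_pdivrMr// mul1r.
exists (a / b)%:A; last by rewrite in_algM in_algV mulrCA divff// mulr1.
apply: (over_int Bgood).
by rewrite (absvalM absP) (nabsV absP) ler_pdivrMr// mul1r.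
Qed.

(* The n-th roots compensate for the value group of F being possibly discrete. *)
Let E x : set R := [set s | exists (a : F) (n : nat),
  [/\ (0 < n)%N, dvB (x ^+ n) a%:A & s = absF a `^ n%:R^-1]].

Definition val_abs x : R := inf (E x).

Let E_ge0 x s : E x s -> 0 <= s.
Proof. by move=> [a [n [_ _ ->]]]; exact: powR_ge0. Qed.

Let E_has_inf x : has_inf (E x).
Proof.
split; last by exists 0 => s /E_ge0.
have [N BtN] := max_subring_arch x.
exists (absF (t ^- N)), (t ^- N), 1%N; split=> //.
  exists ((t ^+ N)%:A * x) => //.
  by rewrite expr1 mulrA -in_algM mulVf ?expf_neq0// scale1r mul1r.
by rewrite invr1 powRr1// (absval_ge0 absP).
Qed.

Lemma val_abs_ge0 x : 0 <= val_abs x.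
Proof.
by apply: lb_le_inf => [|s /E_ge0//]; have [] := E_has_inf x.
Qed.

Let val_abs_le x s : E x s -> val_abs x <= s.
Proof. by move=> Es; apply: ge_inf => //; have [] := E_has_inf x. Qed.

Let val_abs_lb x r : (forall s, E x s -> r <= s) -> r <= val_abs x.
Proof. by move=> h; apply: lb_le_inf => //; have [] := E_has_inf x. Qed.

Lemma val_abs_alg a : val_abs a%:A = absF a.
Proof.
apply/eqP; rewrite eq_le; apply/andP; split.
  apply: val_abs_le; exists a, 1%N; split=> //; last by rewrite invr1 powRr1// (absval_ge0 absP).
  by exists 1; rewrite ?expr1 ?mulr1.
apply: val_abs_lb => _ [b [n [n0 h ->]]].
move: h; rewrite -in_algX dvB_alg (nabsX absP) => h.
rewrite -(ler_pXn2r n0) ?nnegrE ?(absval_ge0 absP) ?powR_ge0//.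
by rewrite powR_natV// (absval_ge0 absP).
Qed.

Lemma val_absM_le x y : val_abs (x * y) <= val_abs x * val_abs y.
Proof.
have key s r : E x s -> E y r -> val_abs (x * y) <= s * r.
  move=> [a [n [n0 h ->]]] [b [m [m0 k ->]]]; apply: val_abs_le.
  exists (a ^+ m * b ^+ n), (n * m)%N; split; first by rewrite muln_gt0 n0.
    rewrite in_algM !in_algX exprMn exprM mulnC exprM; apply: dvBM; exact: dvBX.
  rewrite (absvalM absP) !(nabsX absP) powRM ?exprn_ge0 ?(absval_ge0 absP)//.
  rewrite natrM invfM -!powR_mulrn ?(absval_ge0 absP)// -!powRrM.
  congr (_ `^ _ * _ `^ _); field; rewrite !pnatr_eq0 -!lt0n; exact/andP.
have half r : E y r -> val_abs (x * y) <= val_abs x * r.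
  move=> Er; have := E_ge0 Er; rewrite le_eqVlt => /predU1P[r0|r0].
    have [[s Es] _] := E_has_inf x.
    by have := key s r Es Er; rewrite -r0 !mulr0.
  by rewrite -ler_pdivrMr//; apply: val_abs_lb => s Es; rewrite ler_pdivrMr// key.
have := val_abs_ge0 x; rewrite le_eqVlt => /predU1P[r0|r0].
  have [[s Es] _] := E_has_inf y.
  by have := half s Es; rewrite -r0 !mul0r.
rewrite -ler_pdivrMl//; apply: val_abs_lb => s Es.
by rewrite ler_pdivrMl// half.
Qed.

Lemma val_absV_le x : x != 0 -> val_abs x * val_abs x^-1 <= 1.
Proof.
move=> x0; have := val_abs_ge0 x; rewrite le_eqVlt => /predU1P[<-|x1].
  by rewrite mul0r.
rewrite leNgt mulrC -ltr_pdivrMr// div1r; apply/negP => lt_inv.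
have xi0 : 0 < val_abs x^-1 by rewrite (lt_trans _ lt_inv)// invr_gt0.
have xi : 0 < (val_abs x^-1)^-1 by rewrite invr_gt0.
have lt_inv' : (val_abs x^-1)^-1 < val_abs x by rewrite invf_plt ?posrE.
have ct : 0 < absF t < 1 by rewrite (nabs_gt0 absP) t0.
have [m [n [n0 /andP[h1 h2]]]] := dense_powR ct xi lt_inv'.
have absm : absF (t ^ m) = absF t ^ m.
  by case: m {h1 h2} => k; rewrite ?NegzE -?exprnP ?exprnN ?(nabsV absP) (nabsX absP).
have tm0 : t ^ m != 0 by rewrite expfz_neq0.
have [h|h] := dvB_total (x ^+ n) (t ^ m)%:A.
  have : val_abs x <= (absF t ^ m) `^ n%:R^-1.
    by apply: val_abs_le; exists (t ^ m), n; rewrite absm.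
  by rewrite leNgt h2.
have : val_abs x^-1 <= (absF (t ^ m)^-1) `^ n%:R^-1.
  apply: val_abs_le; exists (t ^ m)^-1, n; split=> //.
  have [z Bz e] := h; exists z => //.
  have tA : (t ^ m)%:A != 0 :> L.
    by rewrite -(scale0r 1); apply: contra_neq tm0 => /in_alg_inj.
  have xn0 : x ^+ n != 0 by rewrite expf_neq0.
  apply: (mulfI xn0); rewrite exprVn divff// mulrCA -e in_algV mulVf//.
rewrite (nabsV absP) absm.
have tp : 0 < absF t ^ m by rewrite exprz_gt0//; case/andP: ct.
have pp : 0 < (absF t ^ m) `^ n%:R^-1 by rewrite powR_gt0.
have -> : (absF t ^ m)^-1 `^ n%:R^-1 = ((absF t ^ m) `^ n%:R^-1)^-1.
  apply: (mulIf (lt0r_neq0 pp)).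
  by rewrite -powRM ?invr_ge0 ?(ltW tp)// !mulVf ?lt0r_neq0// powR1.
by rewrite leNgt invf_plt ?posrE// h1.
Qed.

Lemma val_abs_nonarch : nonarch_absval val_abs.
Proof.
have v1 : val_abs 1 = 1 by rewrite -(scale1r 1) val_abs_alg (nabs1 absP).
have v0 : val_abs 0 = 0 by rewrite -(scale0r 1) val_abs_alg (nabs0 absP).
have vpos x : x != 0 -> 0 < val_abs x.
  move=> x0; rewrite lt_neqAle val_abs_ge0 andbT eq_sym; apply/eqP => vx.
  by have := val_absM_le x x^-1; rewrite vx mul0r divff// v1 ler10.
split.
- exact: val_abs_ge0.
- move=> x; split=> [vx|->//]; apply/eqP/negPn/negP => /vpos.
  by rewrite vx ltxx.
- move=> x y; have [->|x0] := eqVneq x 0; first by rewrite mul0r v0 mul0r.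
  apply/eqP; rewrite eq_le val_absM_le /=.
  rewrite -{1}(mulKf x0 y) -[in X in X <= _]mulrC.
  have h := val_absM_le x^-1 (x * y).
  rewrite (le_trans (ler_wpM2r (val_abs_ge0 _) h))//.
  rewrite mulrC mulrA ler_piMl ?val_abs_ge0//; exact: val_absV_le.
- have mono x y : dvB x y -> val_abs x <= val_abs y.
    move=> xy; apply: val_abs_lb => _ [a [n [n0 h ->]]]; apply: val_abs_le.
    by exists a, n; split=> //; apply: dvB_trans h; exact: dvBX.
  move=> x y; rewrite le_max; have [[z Bz ->]|[z Bz ->]] := dvB_total x y.
    apply/orP; right; apply: mono; exists (z + 1); first exact: BD.
    by ring.
  apply/orP; left; apply: mono; exists (1 + z); first exact: BD.
  by ring.
Qed.

End MaximalSubring.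

Lemma absval_extension : exists absL : L -> R, absval_extends absF absL.
Proof.
have [B Bgood Bmax] := max_subring.
exists (val_abs B); split; [exact: val_abs_nonarch | exact: val_abs_alg].
Qed.

End ChevalleyExtension.

Section IntegralMatrices.
Variables (R : realType) (F : fieldType) (abs : F -> R).
Hypothesis absP : nonarch_absval abs.

Definition mxint m n (A : 'M[F]_(m, n)) := forall i j, abs (A i j) <= 1.
Definition mxclose m n (A B : 'M[F]_(m, n)) := forall i j, abs (A i j - B i j) < 1.

Lemma mxclose_refl m n (A : 'M[F]_(m, n)) : mxclose A A.
Proof. by move=> i j; rewrite subrr (nabs0 absP). Qed.

Lemma mxclose_sym m n (A B : 'M[F]_(m, n)) : mxclose A B -> mxclose B A.
Proof. by move=> AB i j; rewrite (nabsC absP). Qed.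

Lemma mxclose_trans m n (B A C : 'M[F]_(m, n)) :
  mxclose A B -> mxclose B C -> mxclose A C.
Proof. by move=> AB BC i j; apply: (nabs_dist_lt absP (AB i j)). Qed.

Lemma mxint1 n : mxint (1%:M : 'M[F]_n).
Proof. by move=> i j; rewrite mxE (nabs_nat absP). Qed.

Lemma mxint_mul m n q (A : 'M[F]_(m, n)) (B : 'M[F]_(n, q)) :
  mxint A -> mxint B -> mxint (A *m B).
Proof.
move=> hA hB i j; rewrite mxE; apply: (nabs_sum_le absP) => // k _.
exact: (nabsM_le1 absP).
Qed.

Lemma mxclose_mull m n q (A : 'M[F]_(m, n)) (B C : 'M[F]_(n, q)) :
  mxint A -> mxclose B C -> mxclose (A *m B) (A *m C).
Proof.
move=> hA hB i j; rewrite !mxE -sumrB; apply: (nabs_sum_lt absP) => // k _.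
by rewrite -mulrBr; apply: (nabsM_lt1r absP).
Qed.

Lemma mxclose_mulr m n q (A B : 'M[F]_(m, n)) (C : 'M[F]_(n, q)) :
  mxint C -> mxclose A B -> mxclose (A *m C) (B *m C).
Proof.
move=> hC hA i j; rewrite !mxE -sumrB; apply: (nabs_sum_lt absP) => // k _.
by rewrite -mulrBl; apply: (nabsM_lt1l absP).
Qed.

Lemma mxint_det n (A : 'M[F]_n) : mxint A -> abs (\det A) <= 1.
Proof.
move=> hA; apply: (nabs_sum_le absP) => // s _.
apply: (nabsM_le1 absP); last exact: (nabs_prod_le1 absP).
by apply: (nabsX_le1 absP); rewrite (nabsN absP) (nabs1 absP).
Qed.

Lemma mxint_inv n (A : 'M[F]_n) : mxint A -> abs (\det A) = 1 -> mxint (invmx A).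
Proof.
move=> hA dA; have uA : A \in unitmx.
  by rewrite unitmxE unitfE -(nabs_gt0 absP) dA.
move=> i j; rewrite /invmx uA !mxE; apply: (nabsM_le1 absP).
  by rewrite (nabsV absP) dA invr1.
apply: (nabsM_le1 absP).
  by apply: (nabsX_le1 absP); rewrite (nabsN absP) (nabs1 absP).
by apply: mxint_det => k l; rewrite !mxE.
Qed.

Lemma mxclose_mulI n q (A : 'M[F]_n) (B C : 'M[F]_(n, q)) :
  mxint A -> abs (\det A) = 1 -> mxclose (A *m B) (A *m C) -> mxclose B C.
Proof.
move=> hA dA h; have uA : A \in unitmx.
  by rewrite unitmxE unitfE -(nabs_gt0 absP) dA.
by rewrite -(mulKmx uA B) -(mulKmx uA C); apply: mxclose_mull => //; exact: mxint_inv.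
Qed.

Lemma mxunit_row n (A : 'M[F]_n) i : mxint A -> abs (\det A) = 1 ->
  exists j, abs (A i j) = 1.
Proof.
move=> hA dA; apply/not_existsP => h.
have small j : abs (A i j) < 1 by rewrite lt_neqAle hA andbT; apply/eqP/h.
suff : abs (\det A) < 1 by rewrite dA ltxx.
rewrite (expand_det_row A i); apply: (nabs_sum_lt absP) => // j _.
apply: (nabsM_lt1l absP) => //; apply: (nabsM_le1 absP).
  by apply: (nabsX_le1 absP); rewrite (nabsN absP) (nabs1 absP).
by apply: mxint_det => k l; rewrite !mxE.
Qed.

Section Frobenius.
Variable p : nat.
Hypotheses (p_pr : prime p) (p_lt1 : abs p%:R < 1).

Definition mxpow m n k (A : 'M[F]_(m, n)) : 'M[F]_(m, n) :=
  map_mx (fun a => a ^+ k) A.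

Lemma mxint_pow m n k (A : 'M[F]_(m, n)) : mxint A -> mxint (mxpow k A).
Proof. by move=> hA i j; rewrite mxE; apply: (nabsX_le1 absP). Qed.

Lemma mxclose_frobI m n (A B : 'M[F]_(m, n)) : mxint A -> mxint B ->
  mxclose (mxpow p A) (mxpow p B) -> mxclose A B.
Proof.
by move=> hA hB h i j; have := h i j; rewrite !mxE; apply: (nabs_frobB_lt absP p_pr p_lt1).
Qed.

Lemma mxclose_frobM m n q (A : 'M[F]_(m, n)) (B : 'M[F]_(n, q)) :
  mxint A -> mxint B -> mxclose (mxpow p (A *m B)) (mxpow p A *m mxpow p B).
Proof.
move=> hA hB i j; rewrite !mxE.
under [X in abs (_ - X)]eq_bigr do rewrite !mxE -exprMn.
by apply: (nabs_frob_sum absP p_pr p_lt1) => k; apply: (nabsM_le1 absP).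
Qed.

End Frobenius.

Section FrobeniusPeriod.
Variables (p g : nat) (B : 'M[F]_g).
Hypotheses (p_pr : prime p) (p_lt1 : abs p%:R < 1).
Hypotheses (B_int : mxint B) (B_unit : abs (\det B) = 1).

(* The i-th iterate of the semilinear map y |-> B y^(p), as a matrix. *)
Fixpoint frob_iter (i : nat) : 'M[F]_g :=
  if i is i'.+1 then B *m mxpow p (frob_iter i') else 1%:M.

Lemma frob_iter_int i : mxint (frob_iter i).
Proof.
elim: i => [|i IH] /=; first exact: mxint1.
by apply: mxint_mul => //; exact: mxint_pow.
Qed.

Lemma frob_iter_period (T : finType) (cls : F -> T) :
  (forall x y, abs x <= 1 -> abs y <= 1 -> cls x = cls y -> abs (x - y) < 1) ->
  exists2 n, (0 < n)%N & mxclose (frob_iter n) 1%:M.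
Proof.
move=> clsP; pose st (i : nat) : {ffun 'I_g * 'I_g -> T} :=
  [ffun ij => cls (frob_iter i ij.1 ij.2)].
have stP i j : st i = st j -> mxclose (frob_iter i) (frob_iter j).
  move=> e k l; apply: clsP; try exact: frob_iter_int.
  by move/ffunP/(_ (k, l)): e; rewrite !ffunE.
have [i [j [lt_ij e]]] : exists i j, (i < j)%N /\ st i = st j.
  pose N := #|{: {ffun 'I_g * 'I_g -> T}}|.
  have ninj : ~ injective (fun i : 'I_N.+1 => st i).
    by move=> /leq_card; rewrite card_ord ltnn.
  apply: contrapT => h; apply: ninj => i j /= e; apply: ord_inj.
  have [lt|lt|//] := ltngtP (i : nat) j; case: h.
    by exists i, j.
  by exists j, i.
exists (j - i)%N; first by rewrite subn_gt0.
have := stP _ _ e; rewrite -{1}(subnK (ltnW lt_ij)); move: (j - i)%N => d.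
elim: i {e lt_ij} => [|i IH] h; first by rewrite addn0 in h; apply: mxclose_sym.
apply: IH; apply: (mxclose_frobI p_pr p_lt1); try exact: frob_iter_int.
apply: (@mxclose_mulI _ _ B) => //; by rewrite addnS in h.
Qed.

End FrobeniusPeriod.
End IntegralMatrices.

Section PadicResidues.
Variables (R : realType) (p : nat) (Qp : fieldType) (absQp : Qp -> R).
Hypotheses (p_pr : prime p) (Qp_padic : is_padic_field p absQp).

Let absP : nonarch_absval absQp := padic_nonarch Qp_padic.

Lemma padic_abs_p : absQp p%:R = p%:R^-1.
Proof.
have -> : p%:R = ratr p%:R :> Qp by rewrite ratr_nat.
rewrite (padic_ratr Qp_padic) /padic_abs pnatr_eq0 gtn_eqF ?prime_gt0//.
have -> : p%:R = p%:Z%:Q by [].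
rewrite numq_int denq_int /= logn1 -[X in logn p X]expn1 pfactorK//.
Qed.

Lemma padic_abs_p_lt1 : absQp p%:R < 1.
Proof. by rewrite padic_abs_p invf_lt1 ?ltr0n ?ltr1n ?prime_gt1 ?prime_gt0. Qed.

Lemma padic_natr_neq0 n : (0 < n)%N -> n%:R != 0 :> Qp.
Proof.
move=> n0; rewrite -(nabs_gt0 absP) -[n%:R]ratr_nat (padic_ratr Qp_padic) /padic_abs.
by rewrite pnatr_eq0 gtn_eqF// exprz_gt0// ltr0n prime_gt0.
Qed.

Let frob_fixedN w : absQp w <= 1 -> absQp (w ^+ p - w) < 1 ->
  absQp ((- w) ^+ p - - w) < 1.
Proof.
move=> w1 hw; have Nw1 : absQp (- w) <= 1 by rewrite (nabsN absP).
have := nabs_frobD absP p_pr padic_abs_p_lt1 w1 Nw1.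
rewrite subrr expr0n gtn_eqF ?prime_gt0// sub0r (nabsN absP) => h.
have -> : (- w) ^+ p - - w = (w ^+ p + (- w) ^+ p) - (w ^+ p - w) by ring.
exact: (nabsB_lt absP).
Qed.

Lemma padic_residue a : absQp a <= 1 -> exists n : 'I_p, absQp (a - n%:R) < 1.
Proof.
move=> a1; have [q aq] := padic_dense Qp_padic a ltr01.
have q1 : absQp (ratr q) <= 1.
  by rewrite -(subKr a (ratr q)) (nabsB_le absP)// ltW.
suff [n hn] : exists n : 'I_p, absQp (ratr q - n%:R) < 1.
  by exists n; apply: (nabs_dist_lt absP aq).
apply: (nabs_fixed_frob absP p_pr padic_abs_p_lt1) => //.
have [->|q0] := eqVneq q 0.
  by rewrite [ratr _]mul0r expr0n gtn_eqF ?prime_gt0// subrr (nabs0 absP).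
have dden : ~~ (p %| `|denq q|)%N.
  apply/negP => pd; move: q1; rewrite (padic_ratr Qp_padic) /padic_abs (negbTE q0).
  have numN : ~~ (p %| `|numq q|)%N.
    apply/negP => pn; have := coprime_num_den q; rewrite /coprime => /eqP g1.
    have : (p %| gcdn `|numq q| `|denq q|)%N by rewrite dvdn_gcd pn pd.
    by rewrite g1 dvdn1 => /eqP p1; move: (prime_gt1 p_pr); rewrite p1.
  have -> : logn p `|numq q| = 0%N by rewrite lognE (negbTE numN) !andbF.
  rewrite subr0 leNgt => /negP; apply.
  rewrite -exprnP exprn_egt1 ?ltr1n ?prime_gt1//.
  by rewrite -lt0n logn_gt0 mem_primes p_pr pd absz_gt0 denq_neq0.
have den1 : absQp (`|denq q|%:R) = 1 by apply: (nabs_nat_unit absP p_pr padic_abs_p_lt1).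
have pos m n : absQp n%:R = 1 -> absQp ((m%:R / n%:R) ^+ p - m%:R / n%:R) < 1.
  move=> n1; have n0 : n%:R != 0 :> Qp by rewrite -(nabs_gt0 absP) n1.
  have -> : (m%:R / n%:R) ^+ p - m%:R / n%:R =
     ((m%:R ^+ p - m%:R) * n%:R - m%:R * (n%:R ^+ p - n%:R)) / n%:R ^+ p / n%:R :> Qp.
    rewrite expr_div_n; move: (expf_neq0 p n0); move: (m%:R ^+ p) (n%:R ^+ p) => M N N0.
    by field; rewrite n0 N0.
  rewrite !(absvalM absP) !(nabsV absP) (nabsX absP) n1 expr1n invr1 !mulr1.
  apply: (nabsB_lt absP).
    by apply: (nabsM_lt1l absP); [exact: (nabs_nat_fermat absP p_pr padic_abs_p_lt1) | exact: nabs_nat].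
  by apply: (nabsM_lt1r absP); [exact: nabs_nat | exact: (nabs_nat_fermat absP p_pr padic_abs_p_lt1)].
have -> : ratr q = (numq q)%:~R / `|denq q|%:R :> Qp.
  by rewrite /ratr; congr (_ / _); rewrite -[in LHS](gez0_abs (ltW (denq_gt0 q))) pmulrn.
case: (numq q) / (intP (numq q)) => [|m|m]; first exact: (pos 0%N `|denq q|%N).
  by rewrite -pmulrn; exact: pos.
rewrite mulrNz mulNr -pmulrn; apply: frob_fixedN; last exact: pos.
by rewrite (absvalM absP) (nabsV absP) den1 invr1 mulr1 (nabs_nat absP).
Qed.

Variables (K : fieldExtType Qp) (absK : K -> R).
Hypothesis absK_ext : absval_extends absQp absK.

Let absKP : nonarch_absval absK := extends_nonarch absK_ext.

Definition residually_free (X : seq K) :=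
  forall a : nat -> Qp, (forall i, absQp (a i) <= 1) ->
    absK (\sum_(i < size X) a i *: X`_i) < 1 ->
    forall i, (i < size X)%N -> absQp (a i) < 1.

Lemma residually_free_size X : residually_free X -> (size X <= \dim {:K})%N.
Proof.
move=> Xfree; have : free (in_tuple X).
  apply/freeP => k k0 i; apply/eqP/negPn/negP => ki.
  case: (@Order.TotalTheory.arg_maxP _ _ 'I_(size X) i xpredT (absQp \o k)) => // j _ kmax.
  have kj : 0 < absQp (k j).
    by apply: (lt_le_trans _ (kmax i isT)); rewrite (nabs_gt0 absP).
  pose a n := if insub n is Some l then k l / k j else 0.
  have a1 n : absQp (a n) <= 1.
    rewrite /a; case: insubP => [l _ _|_]; last by rewrite (nabs0 absP).
    by rewrite (absvalM absP) (nabsV absP) ler_pdivrMr// mul1r; exact: kmax.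
  have ak (l : 'I_(size X)) : a l = k l / k j by rewrite /a valK.
  have := Xfree a a1; have -> : \sum_(l < size X) a l *: X`_l = 0.
    under eq_bigr do rewrite ak mulrC -scalerA.
    by rewrite -scaler_sumr k0 scaler0.
  rewrite (nabs0 absKP) ltr01 => /(_ isT j (ltn_ord j)).
  by rewrite ak divff -?(nabs_gt0 absP)// (nabs1 absP) ltxx.
by rewrite /free => /eqP <-; apply: dimvS; exact: subvf.
Qed.

Lemma residues_finite : exists (T : finType) (cls : K -> T),
  forall x y, absK x <= 1 -> absK y <= 1 -> cls x = cls y -> absK (x - y) < 1.
Proof.
pose P n := `[< exists X : seq K, [/\ size X = n, residually_free X &
  forall x, x \in X -> absK x <= 1] >].
have P0 : exists n, P n by exists 0%N; apply/asboolP; exists [::]; split.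
have Pb n : P n -> (n <= \dim {:K})%N.
  by move=> /asboolP[X [<- /residually_free_size]].
case: (ex_maxnP P0 Pb) => _ /asboolP[X [<- Xfree X1]] Xmax.
have X1' i : absK X`_i <= 1.
  have [iX|iX] := ltnP i (size X); first by rewrite X1// mem_nth.
  by rewrite nth_default// (nabs0 absKP).
have rep y : absK y <= 1 -> exists n : {ffun 'I_(size X) -> 'I_p},
    absK (y - \sum_i (n i)%:R * X`_i) < 1.
  move=> y1; have : ~ residually_free (y :: X).
    move=> yX; have := Xmax (size X).+1; rewrite ltnn => /(_ _)/negP; apply=> //.
    apply/asboolP; exists (y :: X); split=> // x; rewrite inE => /predU1P[->//|].
    exact: X1.
  move=> /existsNP[a /not_implyP[a1 /not_implyP[]]].
  rewrite /= big_ord_recl /= => small /existsNP[i /not_implyP[iX /negP]].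
  rewrite -leNgt => ai.
  have a01 : absQp (a 0%N) = 1.
    apply/eqP; rewrite eq_le a1 /= leNgt; apply/negP => a0.
    case: i iX ai => [|i] iX ai; first by move: ai; rewrite leNgt a0.
    move: ai; rewrite leNgt => /negP; apply.
    apply: (Xfree (fun n => a n.+1)) => //.
    rewrite -[X in absK X](addKr (a 0%N *: y)) addrC.
    apply: (nabsB_lt absKP) => //; rewrite (nabsZ absK_ext).
    by rewrite (le_lt_trans _ a0)// ler_piMr// (absval_ge0 absP).
  have a00 : a 0%N != 0 by rewrite -(nabs_gt0 absP) a01.
  pose b (j : 'I_(size X)) := - (a j.+1 / a 0%N).
  have b1 j : absQp (b j) <= 1.
    by rewrite (nabsN absP) (absvalM absP) (nabsV absP) a01 invr1 mulr1.
  have [n hn] := choice (fun j => padic_residue (b1 j)).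
  exists [ffun j => n j].
  apply: (nabs_dist_lt absKP (y := \sum_j b j *: X`_j)).
    have -> : y - \sum_j b j *: X`_j =
        (a 0%N)^-1 *: (a 0%N *: y + \sum_(j < size X) a j.+1 *: X`_j).
      rewrite scalerDr scalerA mulVf// scale1r scaler_sumr -sumrN; congr (_ + _).
      by apply: eq_bigr => j _; rewrite scalerA /b scaleNr opprK mulrC.
    by rewrite (nabsZ absK_ext) (nabsV absP) a01 invr1 mul1r.
  rewrite -sumrB; apply: (nabs_sum_lt absKP) => // j _; rewrite ffunE.
  have -> : b j *: X`_j - (n j)%:R * X`_j = (b j - (n j)%:R) *: X`_j.
    by rewrite scalerBl -[(n j)%:R *: _]mulr_algl scaler_nat.
  rewrite (nabsZ absK_ext) (le_lt_trans _ (hn j))// ler_piMr//.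
  exact: (absval_ge0 absP).
have rep' y : exists n : {ffun 'I_(size X) -> 'I_p},
    absK y <= 1 -> absK (y - \sum_i (n i)%:R * X`_i) < 1.
  have [/rep[n hn]|/negP y1] := boolP (absK y <= 1); first by exists n.
  by exists [ffun=> Ordinal (prime_gt0 p_pr)].
have [cls hcls] := choice rep'.
exists {ffun 'I_(size X) -> 'I_p}, cls => x y /hcls hx /hcls hy e.
by apply: (nabs_dist_lt absKP hx); rewrite e (nabsC absKP).
Qed.

End PadicResidues.

Lemma exists_irreducible_factor (F : fieldType) (f : {poly F}) :
  (1 < size f)%N -> exists2 r, r %| f & irreducible_poly r.
Proof.
move=> f_gt1.
pose P n := `[< exists r : {poly F}, [/\ size r = n, (1 < size r)%N & r %| f] >].
have exP : exists n, P n by exists (size f); apply/asboolP; exists f.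
case: (ex_minnP exP) => _ /asboolP[r [<- r_gt1 r_dv]] rmin.
exists r => //; split=> // q q_neq1 q_dv.
have r0 : r != 0 by rewrite -size_poly_gt0 ltnW.
rewrite -dvdp_size_eqp// eqn_leq dvdp_leq//= rmin//; apply/asboolP.
exists q; split=> //; last exact: dvdp_trans q_dv r_dv.
rewrite ltn_neqAle eq_sym q_neq1 size_poly_gt0.
by apply: contraNneq r0 => q0; rewrite q0 dvd0p in q_dv.
Qed.

Lemma splitting_extension (F : fieldType) (f : {poly F}) : f != 0 ->
  exists (L : fieldExtType F) (zs : seq L),
    map_poly (in_alg L) f %= \prod_(z <- zs) ('X - z%:P).
Proof.
have [n] := ubnP (size f); elim: n => // n IH in F f * => lt_f f0.
have [f1|f_gt1] := leqP (size f) 1.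
  exists F^o, [::].
  by rewrite big_nil -size_poly_eq1 size_map_poly eqn_leq f1 size_poly_gt0.
have [r r_dv irr_r] := exists_irreducible_factor f_gt1.
have [K _ [x rx0 _]] := irredp_FAdjoin irr_r.
have : root (map_poly (in_alg K) f) x.
  by rewrite -(divpK r_dv) rmorphM rootM rx0 orbT.
move=> /factor_theorem[q Dq].
have szf : size f = size (q * ('X - x%:P)) by rewrite -Dq size_map_poly.
have q0 : q != 0.
  by apply: contra_neq f0 => q0; apply/eqP; rewrite -size_poly_eq0 szf q0 mul0r size_poly0.
have [|L [zs Dzs]] := IH K q _ q0.
  by move: lt_f; rewrite szf size_mul ?polyXsubC_eq0// size_XsubC addn2.
exists (baseFieldType L), (x%:A :: zs).
have -> : map_poly (in_alg (baseFieldType L)) f =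
    map_poly (in_alg L) (map_poly (in_alg K) f).
  rewrite -map_poly_comp; apply: eq_map_poly => a /=.
  exact: (baseField_scaleE a 1).
by rewrite big_cons Dq mulrC rmorphM /= rmorphB /= map_polyX map_polyC /= eqp_mull.
Qed.

Lemma kummer_extension (F : fieldType) (c : F) (m N : nat) :
  (0 < m)%N -> N%:R != 0 :> F ->
  exists (L : fieldExtType F) (w z : L), w ^+ m = c%:A /\ N.-primitive_root z.
Proof.
move=> m0 N0; have N_gt0 : (0 < N)%N by case: N N0 => //; rewrite eqxx.
have g0 : 'X^m - c%:P != 0 by rewrite monic_neq0 ?monicXnsubC.
have h0 : 'X^N - 1 != 0 :> {poly F} by rewrite monic_neq0 ?monicXnsubC.
have [L [zs Dzs]] := splitting_extension (mulf_neq0 g0 h0).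
exists L.
have Dg : map_poly (in_alg L) ('X^m - c%:P) = 'X^m - (c%:A)%:P.
  by rewrite rmorphB /= map_polyXn map_polyC.
have Dh : map_poly (in_alg L) ('X^N - 1) = 'X^N - 1.
  by rewrite rmorphB /= map_polyXn rmorph1.
have /dvdp_prod_XsubC[mg Dmg] : 'X^m - (c%:A)%:P %| \prod_(z <- zs) ('X - z%:P).
  by rewrite -(eqp_dvdr _ Dzs) rmorphM /= Dg dvdp_mulr.
have /dvdp_prod_XsubC[mh Dmh] : 'X^N - 1 %| \prod_(z <- zs) ('X - z%:P).
  by rewrite -(eqp_dvdr _ Dzs) rmorphM /= Dh dvdp_mull.
have [w wg] : exists w, w \in mask mg zs.
  case E : (mask mg zs) Dmg => [|w s] Dmg; last by exists w; rewrite mem_head.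
  by move: (eqp_size Dmg); rewrite big_nil size_XnsubC// size_poly1 => -[e]; rewrite e in m0.
have LN0 : N%:R != 0 :> L.
  by apply: contra_neq N0; rewrite -(rmorph_nat (in_alg L)) => /eqP; rewrite fmorph_eq0 => /eqP.
have /hasP[z _ z_prim] : has N.-primitive_root (mask mh zs).
  apply: has_prim_root => //.
  - apply/allP => z zh; rewrite unity_rootE -subr_eq0.
    have : root ('X^N - 1) z by rewrite (eqp_root Dmh) root_prod_XsubC.
    by rewrite rootE !hornerE.
  - by rewrite -separable_prod_XsubC -(eqp_separable Dmh); exact: cyclotomic.separable_Xn_sub_1.
  - by have := eqp_size Dmh; rewrite size_prod_XsubC size_XnsubC// => -[->].
exists w, z; split=> //; apply/eqP; rewrite -subr_eq0.
have : root ('X^m - (c%:A)%:P) w by rewrite (eqp_root Dmg) root_prod_XsubC.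
by rewrite rootE !hornerE.
Qed.

Lemma det_sum_rows (F : fieldType) (g : nat) (I : finType) (V : I -> 'M[F]_g) :
  \det (\matrix_(i, k) \sum_a V a i k) =
  \sum_(f : {ffun 'I_g -> I}) \det (\matrix_(i, k) V (f i) i k).
Proof.
rewrite /determinant exchange_big /=; apply: eq_bigr => s _.
rewrite -mulr_sumr; congr (_ * _).
under eq_bigr do rewrite mxE.
rewrite bigA_distr_bigA /=; apply: eq_bigr => f _.
by apply: eq_bigr => i _; rewrite mxE.
Qed.

Lemma sum_expr_unity (F : fieldType) (N : nat) (y : F) :
  y ^+ N = 1 -> y != 1 -> \sum_(a < N) y ^+ a = 0.
Proof.
move=> yN y1; have := subrX1 y N; rewrite yN subrr => /esym/eqP.
by rewrite mulf_eq0 subr_eq0 (negPf y1) => /eqP.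
Qed.

Section FrobeniusBasis.
Variables (R : realType) (F : fieldType) (abs : F -> R) (p g n : nat) (B : 'M[F]_g).
Hypotheses (absP : nonarch_absval abs) (p_pr : prime p) (p_lt1 : abs p%:R < 1).
Hypotheses (B_int : mxint abs B) (n_gt0 : (0 < n)%N)
  (B_period : mxclose abs (frob_iter p B n) 1%:M).
Variable z : F.
Hypothesis z_prim : (p ^ n).-1.-primitive_root z.

Let P := frob_iter p B.
Let N := (p ^ n).-1.

Let pn_gt0 i : (0 < p ^ i)%N. Proof. by rewrite expn_gt0 prime_gt0. Qed.

Let NE : (N.+1 = p ^ n)%N. Proof. by rewrite prednK. Qed.

Let absN : abs N%:R = 1.
Proof.
have h : abs (N%:R - (-1)) < abs (-1).
  rewrite opprK natr1 NE natrX (nabsN absP) (nabs1 absP).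
  by rewrite (nabsX_lt1 absP).
by rewrite (nabs_eq_of_close absP h) (nabsN absP) (nabs1 absP).
Qed.

Let absz : abs z = 1.
Proof.
apply: (nabsX_eq1 absP (prim_order_gt0 z_prim)).
by rewrite (prim_expr_order z_prim) (nabs1 absP).
Qed.

Let orthogonality i : (i < n)%N ->
  \sum_(a < N) z ^+ (a * (p ^ i).-1) = if i == 0%N then N%:R else 0.
Proof.
move=> lt_in; case: eqP => [->|/eqP i0].
  under eq_bigr do rewrite expn0 muln0 expr0.
  by rewrite sumr_const card_ord.
under eq_bigr do rewrite mulnC exprM.
apply: sum_expr_unity.
  by rewrite -exprM mulnC exprM (prim_expr_order z_prim) expr1n.
rewrite -(prim_order_dvd z_prim) gtnNdvd//.
  by rewrite -ltnS prednK// -(expn0 p) ltn_exp2l ?prime_gt1// lt0n.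
by rewrite -ltnS !prednK// ltn_exp2l ?prime_gt1.
Qed.

Let V (a : 'I_N) : 'M[F]_g := \matrix_(j, k) \sum_(i < n) z ^+ (a * (p ^ i).-1) * P i k j.

Let sumV : \matrix_(j, k) \sum_a V a j k = N%:R%:M.
Proof.
apply/matrixP => j k; rewrite !mxE.
under eq_bigr do rewrite mxE.
rewrite exchange_big /=; under eq_bigr do rewrite -mulr_suml.
rewrite (bigD1 (Ordinal n_gt0))// (orthogonality (ltn_ord (Ordinal n_gt0))) big1 /= ?addr0.
  by rewrite !mxE mulr_natr eq_sym.
by move=> i i0; rewrite orthogonality// -(inj_eq val_inj) /= in i0 *; rewrite (negPf i0) mul0r.
Qed.

(* Averaging y |-> B y^(p) over its n iterates yields fixed vectors, and
   orthogonality of the powers of z recovers the unit vectors from them. *)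
Lemma frobenius_basis : exists U : 'M[F]_g,
  [/\ mxint abs U, abs (\det U) = 1 & mxclose abs (B *m mxpow p U) U].
Proof.
have [f hf] : exists f : {ffun 'I_g -> 'I_N}, 1 <= abs (\det (\matrix_(j, k) V (f j) j k)).
  apply/not_existsP => h.
  have : abs (\det (\matrix_(j, k) \sum_a V a j k)) < 1.
    rewrite det_sum_rows; apply: (nabs_sum_lt absP) => // f _.
    by rewrite ltNge; apply/negP/h.
  by rewrite sumV det_scalar (nabsX absP) absN expr1n ltxx.
pose U : 'M[F]_g := \matrix_(k, j) \sum_(i < n) z ^+ (f j * p ^ i) * P i k j.
have P_int i : mxint abs (P i) by apply: frob_iter_int.
have U_int : mxint abs U.
  move=> k j; rewrite mxE; apply: (nabs_sum_le absP) => // i _.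
  by apply: (nabsM_le1 absP); rewrite ?(nabsX absP) ?absz ?expr1n//; exact: P_int.
exists U; split=> //.
  apply/eqP; rewrite eq_le mxint_det//=.
  have UV : U^T = diag_mx (\row_j z ^+ f j) *m \matrix_(j, k) V (f j) j k.
    apply/matrixP => j k; rewrite mul_diag_mx !mxE mulr_sumr; apply: eq_bigr => i _.
    by rewrite mulrA -exprD -mulnS prednK.
  rewrite -det_tr UV det_mulmx det_diag (absvalM absP) (nabs_prod absP) big1 ?mul1r//.
  by move=> j _; rewrite mxE (nabsX absP) absz expr1n.
move=> k j; set c := z ^+ f j.
have cE i : z ^+ (f j * p ^ i) = c ^+ (p ^ i) by rewrite exprM.
have cp : c ^+ (p ^ n) = c.
  by rewrite -NE exprS -exprM mulnC exprM (prim_expr_order z_prim) expr1n mulr1.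
have absc : abs c = 1 by rewrite (nabsX absP) absz expr1n.
have step : \sum_l B k l * (\sum_(i < n) c ^+ (p ^ i.+1) * P i l j ^+ p) =
    \sum_(i < n) c ^+ (p ^ i.+1) * P i.+1 k j.
  under eq_bigr do rewrite mulr_sumr.
  rewrite exchange_big /=; apply: eq_bigr => i _.
  rewrite mxE mulr_sumr; apply: eq_bigr => l _.
  by rewrite mxE mulrCA.
apply: (nabs_dist_lt absP (y := \sum_(i < n) c ^+ (p ^ i.+1) * P i.+1 k j)).
  rewrite -step mxE -sumrB; apply: (nabs_sum_lt absP) => // l _.
  rewrite -mulrBr; apply: (nabsM_lt1r absP) => //; rewrite !mxE.
  have -> : \sum_(i < n) c ^+ (p ^ i.+1) * P i l j ^+ p =
      \sum_(i < n) (z ^+ (f j * p ^ i) * P i l j) ^+ p.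
    by apply: eq_bigr => i _; rewrite cE exprMn expnSr [in LHS]exprM.
  apply: (nabs_frob_sum absP p_pr p_lt1) => i; apply: (nabsM_le1 absP); last exact: P_int.
  by rewrite (nabsX absP) absz expr1n.
rewrite mxE -sumrB.
under eq_bigr do rewrite cE.
rewrite -(big_mkord xpredT (fun i => c ^+ (p ^ i.+1) * P i.+1 k j - c ^+ (p ^ i) * P i k j)).
rewrite (telescope_sumr (fun i => c ^+ (p ^ i) * P i k j))//.
by rewrite cp expn0 expr1 -mulrBr; apply: (nabsM_lt1r absP); rewrite ?absc.
Qed.

End FrobeniusBasis.

Section Newton.
Variables (R : realType) (F : fieldType) (abs : F -> R) (p g : nat).
Hypotheses (absP : nonarch_absval abs) (complete : absval_complete abs)
  (p_lt1 : abs p%:R < 1).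
Variables (h : nat -> F) (E : nat -> 'M[F]_g).
Hypotheses (h0 : h 0%N = 1) (h1 : h 1%N = -1)
  (h_small : forall k, abs (h k.+2) <= abs p%:R ^+ k.+1).
Hypotheses (E0 : E 0%N = 1%:M) (E_int : forall k, mxint abs (E k)).

Implicit Types y : 'cV[F]_g.

Definition log_term k y : 'cV[F]_g := h k *: (E k *m mxpow (p ^ k) y).
Definition log_sum n y : 'cV[F]_g := \sum_(k < n) log_term k y.

(* y is a zero of the series iff it is a fixed point of the limit of these maps. *)
Definition newton_map n y : 'cV[F]_g :=
  E 1%N *m mxpow p y - \sum_(k < n) log_term k.+2 y.

Definition log_zero y :=
  forall i eps, 0 < eps -> exists N, forall n, (N <= n)%N -> abs (log_sum n y i 0) < eps.

Lemma uniform_eventually (Q : 'I_g -> nat -> Prop) :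
  (forall i, exists N, forall n, (N <= n)%N -> Q i n) ->
  exists N, forall n, (N <= n)%N -> forall i, Q i n.
Proof.
move=> /choice[N hN]; exists (\max_i N i) => n hn i; apply: hN.
by apply: leq_trans hn; exact: leq_bigmax.
Qed.

Lemma log_sumE n y : log_sum n.+2 y = y - newton_map n y.
Proof.
have t0 : log_term 0 y = y.
  by rewrite /log_term h0 scale1r E0 mul1mx; apply/matrixP => i j; rewrite mxE expn0 expr1.
have t1 : log_term 1 y = - (E 1%N *m mxpow p y).
  by rewrite /log_term h1 scaleN1r expn1.
rewrite /log_sum -(big_mkord xpredT (fun k => log_term k y)).
rewrite big_nat_recl// big_nat_recl// big_mkord t0 t1 /newton_map.
by rewrite opprB addrA addrAC addrA.
Qed.

Lemma log_term_small k y i : mxint abs y -> abs (log_term k.+2 y i 0) <= abs p%:R ^+ k.+1.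
Proof.
move=> y1; rewrite mxE (absvalM absP) (le_trans _ (h_small k))//.
rewrite ler_piMr ?(absval_ge0 absP)//.
by apply: mxint_mul => //; exact: mxint_pow.
Qed.

Let ballc (c : R) y y' := forall i, abs (y i 0 - y' i 0) <= c.

Let p_ge0 : 0 <= abs p%:R. Proof. exact: absval_ge0 absP _. Qed.

Let pX_le k : abs p%:R ^+ k.+1 <= abs p%:R.
Proof. by rewrite exprS ler_piMr// exprn_ile1// ltW. Qed.

Lemma newton_map_int n y : mxint abs y -> mxint abs (newton_map n y).
Proof.
move=> y1 i j; rewrite ord1 !mxE; apply: (nabsB_le absP).
  have := mxint_mul absP (E_int 1%N) (mxint_pow absP p y1).
  by move=> /(_ i 0); rewrite mxE.
rewrite summxE; apply: (nabs_sum_le absP) => // k _.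
by rewrite (le_trans (log_term_small _ _ y1))// (le_trans (pX_le _))// ltW.
Qed.

Lemma newton_mapE n y i : newton_map n y i 0 = \sum_l E 1%N i l * y l 0 ^+ p -
  \sum_(k < n) h k.+2 * \sum_l E k.+2 i l * y l 0 ^+ (p ^ k.+2).
Proof.
rewrite !mxE summxE; congr (_ - _); apply: eq_bigr => k _; rewrite ?mxE//.
by congr (_ * _); apply: eq_bigr => l _; rewrite mxE.
Qed.

Lemma newton_contract n c y y' : mxint abs y -> mxint abs y' -> 0 <= c ->
  ballc c y y' -> ballc (c * Num.max (abs p%:R) c) (newton_map n y) (newton_map n y').
Proof.
move=> y1 y1' c0 yy' i.
have m0 : 0 <= Num.max (abs p%:R) c by rewrite le_max p_ge0.
have -> : newton_map n y i 0 - newton_map n y' i 0 =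
   \sum_l E 1%N i l * (y l 0 ^+ p - y' l 0 ^+ p) -
   \sum_(k < n) h k.+2 * \sum_l E k.+2 i l * (y l 0 ^+ (p ^ k.+2) - y' l 0 ^+ (p ^ k.+2)).
  have swap (a b a' b' : F) : a - b - (a' - b') = (a - a') - (b - b') by ring.
  rewrite !newton_mapE swap -!sumrB.
  congr (_ - _); apply: eq_bigr => k _; first by rewrite mulrBr.
  by rewrite -mulrBr -sumrB; congr (_ * _); apply: eq_bigr => l _; rewrite mulrBr.
apply: (nabsB_le absP); apply: (nabs_sum_le absP) => [|l _]; rewrite ?mulr_ge0//.
  rewrite (absvalM absP) (le_trans (ler_piMl (absval_ge0 absP _) (E_int _ _ _)))//.
  rewrite (le_trans (nabs_subX_le absP p (y1 _ _) (y1' _ _)))// ler_pM ?(absval_ge0 absP)//.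
    by rewrite le_max p_ge0.
  by rewrite ge_max !le_max lexx yy' orbT.
rewrite (absvalM absP) mulrC ler_pM ?(absval_ge0 absP)//; last first.
  by rewrite le_max (le_trans (h_small l) (pX_le l)).
apply: (nabs_sum_le absP) => // k _.
rewrite (absvalM absP) (le_trans (ler_piMl (absval_ge0 absP _) (E_int _ _ _)))//.
exact: le_trans (nabs_subX_le1 absP _ (y1 _ _) (y1' _ _)) (yy' _).
Qed.

Lemma newton_map_nonexp n c y y' : mxint abs y -> mxint abs y' -> 0 <= c ->
  c <= 1 -> ballc c y y' -> ballc c (newton_map n y) (newton_map n y').
Proof.
move=> y1 y1' c0 c1 yy' i; apply: le_trans (newton_contract n y1 y1' c0 yy' i) _.
by rewrite ler_piMr// ge_max c1 ltW.
Qed.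

Lemma log_zero_residue y : mxint abs y -> log_zero y ->
  mxclose abs (E 1%N *m mxpow p y) y.
Proof.
move=> y1 zy i j; rewrite ord1 (nabsC absP).
have [N /(_ N.+2)] := zy i 1 ltr01; rewrite log_sumE => hN.
have -> : y i 0 - (E 1%N *m mxpow p y) i 0 =
    (y - newton_map N y) i 0 - \sum_(k < N) log_term k.+2 y i 0.
  by rewrite !mxE summxE; ring.
apply: (nabsB_lt absP); first by apply: hN; rewrite ltnW.
apply: (nabs_sum_lt absP) => // k _.
exact: le_lt_trans (log_term_small _ _ y1) (le_lt_trans (pX_le _) p_lt1).
Qed.

Lemma log_zero_unique y y' : mxint abs y -> mxint abs y' ->
  mxclose abs y y' -> log_zero y -> log_zero y' -> y = y'.
Proof.
move=> y1 y1' yy' zy zy'; apply/matrixP => i j; rewrite ord1 {j}.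
apply/eqP; rewrite -subr_eq0; apply/negPn/negP => ne.
case: (@Order.TotalTheory.arg_maxP _ _ 'I_g i xpredT (fun l => abs (y l 0 - y' l 0))) => // m _ mmax.
pose c := abs (y m 0 - y' m 0).
have c0 : 0 < c by apply: lt_le_trans (mmax i isT); rewrite (nabs_gt0 absP).
have c1 : c < 1 := yy' m 0.
have [N hN] := zy m c c0; have [N' hN'] := zy' m c c0.
pose n := maxn N N'.
have Nn : (N <= n.+2)%N by rewrite (leq_trans (leq_maxl N N'))// 2?ltnW.
have Nn' : (N' <= n.+2)%N by rewrite (leq_trans (leq_maxr N N'))// 2?ltnW.
have := newton_contract n y1 y1' (ltW c0) (fun l => mmax l isT) m => hc.
suff : c < c by rewrite ltxx.
have e : y m 0 - y' m 0 = (log_sum n.+2 y m 0 - log_sum n.+2 y' m 0)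
   + (newton_map n y m 0 - newton_map n y' m 0).
  have Se z : log_sum n.+2 z m 0 = z m 0 - newton_map n z m 0 by rewrite log_sumE !mxE.
  by rewrite !Se; ring.
rewrite {1}/c e; apply: (nabsD_lt absP).
  by apply: (nabsB_lt absP); [exact: hN | exact: hN'].
by apply: le_lt_trans hc _; rewrite gtr_pMr// gt_max p_lt1.
Qed.

Lemma log_zero_exists y0 : mxint abs y0 -> mxclose abs (E 1%N *m mxpow p y0) y0 ->
  exists y, [/\ mxint abs y, mxclose abs y y0 & log_zero y].
Proof.
move=> y01 y0p.
pose u := fix u n := if n is m.+1 then newton_map m (u m) else y0.
have u_int n : mxint abs (u n) by elim: n => //= n IH; exact: newton_map_int.
have [r [r1 pr r0]] : exists r : R, [/\ 0 <= r < 1, abs p%:R <= r ^+ 2 & ballc r (u 1%N) (u 0%N)].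
  pose r0 := \big[Num.max/Num.sqrt (abs p%:R)]_(i < g) abs (u 1%N i 0 - u 0%N i 0).
  have sr0 : Num.sqrt (abs p%:R) <= r0 by rewrite /r0 bigmax_ge_id.
  have r00 : 0 <= r0 := le_trans (sqrtr_ge0 _) sr0.
  exists r0; split.
  - rewrite r00 /=; apply: bigmax_lt => [|i _].
      by rewrite -[X in _ < X]sqrtr1 ltr_sqrt.
    by rewrite /= /newton_map big_ord0 subr0; exact: y0p.
  - by rewrite -[X in X <= _]sqr_sqrtr// lerXn2r// nnegrE ?sqrtr_ge0.
  - by move=> i; exact: le_bigmax.
have /andP[rge0 rlt1] := r1.
have rX n : r ^+ n.+1 <= r by rewrite exprS ler_piMr// exprn_ile1// ltW.
have pr1 : abs p%:R <= r by exact: le_trans pr (rX 1%N).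
have ustep n : ballc (r ^+ n.+1) (u n.+1) (u n).
  elim: n => [|n IH]; first by rewrite expr1.
  move=> i; apply: (nabs_dist_le absP (y := newton_map n.+1 (u n) i 0)).
    have := newton_contract n.+1 (u_int n.+1) (u_int n) (exprn_ge0 n.+1 rge0) IH i.
    move=> /le_trans; apply.
    by rewrite [leRHS]exprSr ler_wpM2l ?exprn_ge0// ge_max pr1 rX.
  have -> : newton_map n.+1 (u n) i 0 - u n.+1 i 0 = - log_term n.+2 (u n) i 0.
    by rewrite /= /newton_map big_ord_recr !mxE /=; ring.
  rewrite (nabsN absP) (le_trans (log_term_small _ _ (u_int n)))//.
  rewrite (le_trans (lerXn2r n.+1 _ _ pr)) ?nnegrE ?exprn_ge0// -exprM.
  by rewrite ler_wiXn2l ?(ltW rlt1)//; lia.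
have ucauchy i : cauchy abs (fun n => u n i 0).
  apply: (cauchy_succ absP) => eps e0.
  have [N hN] := exists_expn_lt r1 e0; exists N => n hn.
  by apply: le_lt_trans (ustep n i) (hN _ _); rewrite ltnW.
have [l hl] := choice (fun i => (completeP absP).1 complete _ (ucauchy i)).
pose y : 'cV[F]_g := \col_i l i.
have ylim eps : 0 < eps -> exists N, forall n, (N <= n)%N -> forall i, abs (u n i 0 - y i 0) < eps.
  move=> e0; apply: (uniform_eventually (Q := fun i n => abs (u n i 0 - y i 0) < eps)) => i.
  by have [N hN] := hl i eps e0; exists N => n; rewrite mxE; exact: hN.
have [N1 hN1] := ylim 1 ltr01.
have y_int : mxint abs y.
  move=> i j; rewrite ord1 -(subKr (u N1 i 0) (y i 0)); apply: (nabsB_le absP).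
    exact: u_int.
  by rewrite ltW// hN1.
have u_close n : mxclose abs (u n) y0.
  elim: n => [|n IH]; first exact: mxclose_refl.
  apply: (mxclose_trans absP (B := u n)) => // i j; rewrite ord1.
  by apply: le_lt_trans (ustep n i) (le_lt_trans (rX n) rlt1).
exists y; split=> //.
  apply: (mxclose_trans absP (B := u N1)) => // i j.
  by rewrite ord1 (nabsC absP) hN1.
move=> i eps e0.
pose c := Num.min (eps / 2) 1.
have c0 : 0 < c by rewrite lt_min divr_gt0//=.
have c1 : c <= 1 by rewrite ge_min lexx orbT.
have ce : c < eps.
  by rewrite gt_min; apply/orP; left; rewrite ltr_pdivrMr// ltr_pMr// ltr1n.
have [N hN] := ylim c c0; exists N.+2 => -[|[|n]]// hn; rewrite !ltnS in hn.
have -> : log_sum n.+2 y i 0 = (newton_map n (u n) i 0 - newton_map n y i 0)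
    - (u n.+1 i 0 - y i 0) by rewrite log_sumE !mxE /=; ring.
apply: (nabsB_lt absP); last by rewrite (lt_trans _ ce)// hN// ltnW.
apply: le_lt_trans ce; apply: newton_map_nonexp => //; first exact: ltW.
by move=> j; rewrite ltW// hN.
Qed.

End Newton.

Lemma card_finset (T : finType) (x0 : T) (Z : {set T}) :
  [set x | x \in Z] #= `I_#|Z|.
Proof.
have -> : [set x | x \in Z] = nth x0 (enum Z) @` `I_#|Z|.
  apply/seteqP; split=> [x /= xZ|_ [i /= iZ <-]].
    exists (index x (enum Z)); last by rewrite nth_index// mem_enum.
    by rewrite /= cardE index_mem mem_enum.
  by rewrite -mem_enum mem_nth// -cardE.
apply: inj_card_eq => i j; rewrite !inE => iZ jZ /eqP.
by rewrite nth_uniq -?cardE ?enum_uniq// => /eqP.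
Qed.

Lemma frobenius_matrix0 (R : realType) (F : fieldType) (abs : F -> R)
    (A : set (int -> F)) (p g : nat) (mu : 'I_g -> nat) (e : nat -> 'M[F]_g) :
  is_subalgebra A -> gap_enum A mu -> frobenius_matrices abs A p mu e ->
  e 0%N = 1%:M.
Proof.
move=> A_subalg [mu_incr mu_range] e_frob.
have mu_inj : injective mu.
  move=> i j e_ij; apply: ord_inj; have [lt|lt|//] := ltngtP (i : nat) j.
    by have := mu_incr _ _ lt; rewrite e_ij ltnn.
  by have := mu_incr _ _ lt; rewrite e_ij ltnn.
have mu_gap i : ~ degrees A (mu i).
  suff : (~` degrees A) (mu i) by [].
  by rewrite -mu_range; exists i.
apply/matrixP => i j; have [_ [a [Aa _] [t [t0 _] at_eq]]] := e_frob 0%N j.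
have v_eq (n : nat) : a n%:Z = (mu j == n)%:R - \sum_k e 0%N k j * (mu k == n)%:R.
  have := congr1 (fun v => v n%:Z) at_eq.
  rewrite /= !fctE t0// addr0 => ->.
  rewrite expn0 muln1 fct_sumE /Tpow eqz_nat eq_sym; congr (_ - _).
  by apply: eq_bigr => k _; rewrite /= eqz_nat eq_sym.
have a0 (n : nat) : a n%:Z = 0.
  apply/eqP/negPn/negP => an.
  have [m hm] := subalg_laurent A_subalg Aa.
  pose P k := a k%:Z != 0.
  have Pb k : P k -> (k <= `|m|)%N.
    move=> Pk; rewrite leqNgt; apply/negP => lt; move: Pk; rewrite /P hm ?eqxx//.
    by rewrite (le_lt_trans (lez_abs m))// ltz_nat.
  case: (ex_maxnP (ex_intro P n an) Pb) => d Pd dmax.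
  have degd : degrees A d.
    exists a => //; split=> // -[k|//] lt_dk; apply/eqP/negPn/negP => /dmax.
    by rewrite leqNgt -ltz_nat lt_dk.
  have : (mu j == d) || [exists k, mu k == d].
    rewrite -[X in is_true X]negbK negb_or negb_exists; apply/negP => /andP[/negPf hj /forallP hk].
    move: Pd; rewrite /P v_eq hj big1 ?subr0 ?eqxx// => k _.
    by rewrite (negPf (hk k)) mulr0.
  by move=> /orP[/eqP|/existsP[k /eqP]] md; rewrite -md in degd; exact: mu_gap degd.
have := v_eq (mu i); rewrite a0 (bigD1 i)//= eqxx mulr1 big1 ?addr0.
  by move=> /esym/eqP; rewrite subr_eq0 (inj_eq mu_inj) => /eqP <-; rewrite mxE eq_sym.
by move=> k ki; rewrite (inj_eq mu_inj) (negPf ki) mulr0.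
Qed.

Section LogCoefficients.
Variables (R : realType) (F : fieldType) (abs : F -> R) (p : nat) (w : F).
Hypotheses (absP : nonarch_absval abs) (p_pr : prime p) (p_lt1 : abs p%:R < 1)
  (p_neq0 : p%:R != 0 :> F) (w_root : w ^+ p.-1 = - p%:R).

(* l(w y) = w * \sum_k log_coef k * e_k y^(p^k). *)
Definition log_coef k : F := p%:R ^- k * w ^+ (p ^ k).-1.

Lemma log_coef0 : log_coef 0 = 1.
Proof. by rewrite /log_coef !expr0 invr1 mulr1. Qed.

Lemma log_coef1 : log_coef 1 = -1.
Proof. by rewrite /log_coef expn1 w_root expr1 mulrN mulVf. Qed.

Lemma log_coef_small k : abs (log_coef k.+2) <= abs p%:R ^+ k.+1.
Proof.
pose s := (\sum_(i < k.+2) p ^ i)%N.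
have sE : (p ^ k.+2).-1 = (p.-1 * s)%N by rewrite predn_exp.
have s_ge : (k.+2 + k.+1 <= s)%N.
  rewrite /s big_ord_recl expn0 addSn add1n ltnS addnn.
  rewrite -muln2 -[X in (X * _ <= _)%N](card_ord k.+1) -sum_nat_const.
  apply: leq_sum => i _; rewrite lift0.
  by rewrite (leq_trans (prime_gt1 p_pr))// -{1}(expn1 p) leq_exp2l ?prime_gt1.
have p0 : 0 < abs p%:R by rewrite (nabs_gt0 absP).
rewrite /log_coef sE exprM w_root (absvalM absP) (nabsV absP) !(nabsX absP) (nabsN absP).
rewrite ler_pdivrMl ?exprn_gt0// -exprD.
by rewrite ler_wiXn2l ?(absval_ge0 absP)// ltW.
Qed.

Lemma root_radius : abs p%:R `^ (p%:R - 1)^-1 = abs w.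
Proof.
have -> : p%:R - 1 = p.-1%:R :> R by rewrite -{1}(prednK (prime_gt0 p_pr)) -natr1 addrK.
rewrite -[abs p%:R](nabsN absP) -w_root (nabsX absP) powR_Xn ?(absval_ge0 absP)//.
by rewrite -ltnS prednK ?prime_gt0// prime_gt1.
Qed.

End LogCoefficients.

Section Counting.
Variables (R : realType) (p g : nat) (K : fieldType) (L : fieldExtType K).
Variables (abs : L -> R) (e : nat -> 'M[K]_g) (w : L) (U : 'M[L]_g).
Hypotheses (absP : nonarch_absval abs) (complete : absval_complete abs).
Hypotheses (p_pr : prime p) (p_lt1 : abs p%:R < 1) (p_neq0 : p%:R != 0 :> L)
  (w_root : w ^+ p.-1 = - p%:R).

Let E k : 'M[L]_g := map_mx (in_alg L) (e k).
Let h := log_coef p w.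

Hypotheses (e0 : e 0%N = 1%:M) (E_int : forall k, mxint abs (E k)).
Hypotheses (U_int : mxint abs U) (U_unit : abs (\det U) = 1)
  (U_frob : mxclose abs (E 1%N *m mxpow p U) U).

Let h0 : h 0%N = 1 := log_coef0 p w.
Let h1 : h 1%N = -1 := log_coef1 p_neq0 w_root.
Let h_small := log_coef_small absP p_pr p_lt1 p_neq0 w_root.
Let E0 : E 0%N = 1%:M. Proof. by rewrite /E e0 map_mx1. Qed.

Let p1_gt0 : (0 < p.-1)%N.
Proof. by rewrite -ltnS prednK ?prime_gt0// prime_gt1. Qed.

Let w_neq0 : w != 0.
Proof.
by apply: contra_neq p_neq0 => w0; rewrite -[p%:R]opprK -w_root w0 expr0n gtn_eqF ?oppr0.
Qed.

Let absw : torsion_radius p abs = abs w.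
Proof. exact: root_radius. Qed.

Let absw_lt1 : abs w < 1.
Proof.
by rewrite -(nabsX_lt1 absP _ p1_gt0) w_root (nabsN absP).
Qed.

Let absw_gt0 : 0 < abs w. Proof. by rewrite (nabs_gt0 absP). Qed.

Lemma l_partialZ y n : l_partial p e (w *: y) n = w *: log_sum p h E n y.
Proof.
rewrite /l_partial /log_sum scaler_sumr; apply: eq_bigr => k _.
have -> : map_mx (fun a => a ^+ (p ^ k)) (w *: y) = w ^+ (p ^ k) *: mxpow (p ^ k) y.
  by apply/matrixP => i j; rewrite !mxE exprMn.
rewrite /log_term -scalemxAr !scalerA; congr (_ *: _).
rewrite /h /log_coef mulrCA -exprS prednK// expn_gt0 prime_gt0//.
Qed.

Lemma l_value0P y : l_value p abs e (w *: y) 0 <-> log_zero abs p h E y.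
Proof.
have lE i n : l_partial p e (w *: y) n i 0 - (0 : 'cV[L]_g) i 0 = w * log_sum p h E n y i 0.
  by rewrite l_partialZ !mxE subr0.
have absE (u : nat -> L) : (forall n, 0 <= abs (u n)) by move=> n; exact: absval_ge0 absP _.
split=> H i.
  move=> eps eps0; have /(cvg0P (absE _))/(_ (abs w * eps)) := H i.
  rewrite pmulr_rgt0// => /(_ eps0)[N hN]; exists N => n /hN.
  by rewrite lE (absvalM absP) ltr_pM2l.
apply/(cvg0P (absE _)) => eps eps0.
have [N hN] := H i _ (divr_gt0 eps0 absw_gt0); exists N => n /hN.
by rewrite lE (absvalM absP) ltr_pdivlMr// mulrC.
Qed.

Lemma T1P x : T1 p abs e x <->
  exists y, [/\ x = w *: y, mxint abs y & log_zero abs p h E y].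
Proof.
split=> [[_ lx xr]|[y [-> y1 zy]]].
  have xE : x = w *: (w^-1 *: x) by rewrite scalerA divff// scale1r.
  exists (w^-1 *: x); split=> //; last by apply/l_value0P; rewrite -xE.
  move=> i j; rewrite ord1 mxE (absvalM absP) (nabsV absP) ler_pdivrMl// mulr1.
  rewrite -absw (le_trans _ xr)//.
  exact: (le_bigmax _ (fun i => abs (x i 0)) i).
have wy i : abs ((w *: y) i 0) <= abs w.
  by rewrite mxE (absvalM absP) ler_piMr// (absval_ge0 absP).
split=> [i||]; first exact: le_lt_trans (wy i) absw_lt1.
  exact/l_value0P.
by rewrite absw; apply: bigmax_le => [|i _]; rewrite ?(absval_ge0 absP).
Qed.

Definition digit_col (z : {ffun 'I_g -> 'I_p}) : 'cV[L]_g := \col_i (z i)%:R.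

Let digit_int z : mxint abs (digit_col z).
Proof. by move=> i j; rewrite mxE (nabs_nat absP). Qed.

Let digit_inj z z' : mxclose abs (digit_col z) (digit_col z') -> z = z'.
Proof.
move=> zz'; apply/ffunP => i; apply: ord_inj.
apply: (nabs_nat_sub_lt absP p_pr p_lt1) => //.
by have := zz' i 0; rewrite !mxE.
Qed.

Let U_int_mul (y : 'cV[L]_g) : mxint abs y -> mxint abs (U *m y).
Proof. exact: mxint_mul. Qed.

Let frob_U (y : 'cV[L]_g) : mxint abs y ->
  mxclose abs (E 1%N *m mxpow p (U *m y)) (U *m mxpow p y).
Proof.
move=> y1.
apply: (mxclose_trans absP (B := E 1%N *m (mxpow p U *m mxpow p y))).
  by apply: mxclose_mull => //; exact: mxclose_frobM.
by rewrite mulmxA; apply: mxclose_mulr => //; exact: mxint_pow.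
Qed.

Let lift_digits z : exists y, [/\ mxint abs y, mxclose abs y (U *m digit_col z) &
  log_zero abs p h E y].
Proof.
apply: log_zero_exists => //; first exact: U_int_mul.
apply: (mxclose_trans absP (frob_U (digit_int z))); apply: mxclose_mull => // i j.
by rewrite !mxE; exact: (nabs_nat_fermat absP p_pr p_lt1).
Qed.

Let digits_of y : mxint abs y -> log_zero abs p h E y ->
  exists z, mxclose abs y (U *m digit_col z).
Proof.
move=> y1 zy; have uU : U \in unitmx by rewrite unitmxE unitfE -(nabs_gt0 absP) U_unit.
pose v := invmx U *m y; have yE : y = U *m v by rewrite mulKVmx.
have v1 : mxint abs v by apply: mxint_mul => //; exact: mxint_inv.
have vv : mxclose abs (mxpow p v) v.
  apply: (@mxclose_mulI _ _ _ absP _ _ U) => //.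
  apply: (mxclose_trans absP (mxclose_sym absP (frob_U v1))).
  by rewrite -yE; exact: (log_zero_residue absP p_lt1 h0 h1 h_small E0 E_int).
have res i : exists a : 'I_p, abs (v i 0 - a%:R) < 1.
  by apply: (nabs_fixed_frob absP p_pr p_lt1) => //; have := vv i 0; rewrite mxE.
have [a ha] := choice res.
exists [ffun i => a i]; rewrite yE; apply: mxclose_mull => // i j.
by rewrite ord1 [digit_col _ i 0]mxE ffunE.
Qed.

Lemma T1_param : exists f : {ffun 'I_g -> 'I_p} -> 'cV[L]_g,
  [/\ injective f, range f = T1 p abs e &
      forall z i, abs ((U *m digit_col z) i 0) = 1 -> abs (f z i 0) = abs w].
Proof.
have [f hf] := choice lift_digits.
have f_int z : mxint abs (f z) by have [] := hf z.
have f_close z : mxclose abs (f z) (U *m digit_col z) by have [] := hf z.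
have f_zero z : log_zero abs p h E (f z) by have [] := hf z.
exists (fun z => w *: f z); split.
- move=> z z' /(scalerI w_neq0) e_zz'; apply: digit_inj.
  apply: (@mxclose_mulI _ _ _ absP _ _ U) => //.
  by apply: (mxclose_trans absP (mxclose_sym absP (f_close z))); rewrite e_zz'.
- apply/seteqP; split=> [_ [z _ <-]|x /T1P[y [-> y1 zy]]].
    by apply/T1P; exists (f z).
  have [z yz] := digits_of y1 zy; exists z => //; congr (_ *: _).
  apply: (log_zero_unique absP p_lt1 h0 h1 h_small E0 E_int) => //.
  by apply: (mxclose_trans absP (f_close z)); exact: mxclose_sym.
- move=> z i Uz; rewrite mxE (absvalM absP) (_ : abs (f z i 0) = 1) ?mulr1//.
  by rewrite -Uz; apply: (nabs_eq_of_close absP); rewrite Uz; exact: f_close.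
Qed.

Lemma card_T1 : T1 p abs e #= `I_(p ^ g)%N.
Proof.
have [f [f_inj <- _]] := T1_param.
apply: (card_eq_trans (inj_card_eq (in2W f_inj))).
have := card_finset ([ffun=> Ordinal (prime_gt0 p_pr)]) [set: {ffun 'I_g -> 'I_p}]%SET.
rewrite cardsT card_ffun !card_ord; congr (is_true (_ #= _)).
by apply/seteqP; split=> // z _ /=; rewrite finset.in_setT.
Qed.

Definition small_digits (i : 'I_g) : {set {ffun 'I_g -> 'I_p}} :=
  finset (fun z => abs ((U *m digit_col z) i 0) < 1).

Lemma card_small_digits (i : 'I_g) : (#|small_digits i| <= p ^ g.-1)%N.
Proof.
have [j0 Uj0] := mxunit_row absP i U_int U_unit.
pose r (z : {ffun 'I_g -> 'I_p}) : {ffun 'I_g.-1 -> 'I_p} := [ffun k => z (lift j0 k)].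
have -> : (p ^ g.-1 = #|{: {ffun 'I_g.-1 -> 'I_p}}|)%N by rewrite card_ffun !card_ord.
rewrite -(card_in_imset (f := r)); first exact: max_card.
move=> z z'; rewrite !inE => hz hz' rr.
have zz' j : j != j0 -> z j = z' j.
  case: (unliftP j0 j) => [k ->|->]; last by rewrite eqxx.
  by move=> _; move/ffunP/(_ k): rr; rewrite !ffunE.
apply/ffunP => j; have [->|/zz'//] := eqVneq j j0.
apply: ord_inj; apply: (nabs_nat_sub_lt absP p_pr p_lt1) => //.
have := nabsB_lt absP hz hz'; rewrite !mxE -sumrB (bigD1 j0)//= big1 => [|k kj].
  by rewrite addr0 !mxE -mulrBr (absvalM absP) Uj0 mul1r.
by rewrite !mxE zz'// subrr.
Qed.

Lemma card_T1_coord (i : 'I_g) : `I_(p ^ g - p ^ g.-1)%N #<=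
  [set x : 'cV[L]_g | T1 p abs e x /\ abs (x i 0) = torsion_radius p abs].
Proof.
have [f [f_inj fT1 f_coord]] := T1_param.
pose Z := small_digits i.
have ZC : (p ^ g - p ^ g.-1 <= #|~: Z|)%N.
  by rewrite cardsCs finset.setCK card_ffun !card_ord leq_sub2l// card_small_digits.
rewrite -card_le_II in ZC; apply: card_le_trans ZC _.
have /card_eqPle[_ leZ] := card_finset [ffun=> Ordinal (prime_gt0 p_pr)] (~: Z).
apply: card_le_trans leZ _.
have /card_eqPle[_ lef] := inj_card_eq (A := [set z | z \in ~: Z]) (in2W f_inj).
apply: card_le_trans lef _.
apply: subset_card_le => _ [z /= zZ <-]; split; first by rewrite -fT1; exists z.
rewrite absw; apply: f_coord; apply/eqP; rewrite eq_le U_int_mul//=.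
by move: zZ; rewrite !inE -leNgt.
Qed.

End Counting.

Lemma integer_units_abs (R : realType) (F : fieldType) (abs : F -> R) (x : F) :
  nonarch_absval abs -> integer_units abs x -> abs x = 1.
Proof.
move=> absP [x1 [y y1 xy]]; apply/eqP; rewrite eq_le x1 /=.
by rewrite -(nabs1 absP) -xy (absvalM absP) ler_piMr// (absval_ge0 absP).
Qed.

Theorem proposition3p11 (R : realType) (p : nat) (p_prime : prime p)
    (Qp : fieldType) (absQp : Qp -> R) (Qp_padic : is_padic_field p absQp)
    (K : fieldExtType Qp) (absK : K -> R)
    (absK_ext : absval_extends absQp absK)
    (A : set (int -> K)) (A_subalg : is_subalgebra A)
    (A_const : A `&` power_series K = constants K)
    (g : nat) (g_gt0 : (0 < g)%N)
    (A_dim : quotient_dim (laurent K) (sumset A (power_series K)) g)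
    (A_int : strictly_integral absK A)
    (mu : 'I_g -> nat) (mu_gaps : gap_enum A mu)
    (e : nat -> 'M[K]_g) (e_frob : frobenius_matrices absK A p mu e)
    (e1_unit : integer_units absK (\det (e 1%N))) :
  exists (K' : fieldExtType K) (absK' : K' -> R),
    [/\ absval_extends absK absK',
        T1 p absK' e #= `I_(p ^ g)%N
      & `I_(p ^ g - p ^ g.-1)%N #<=
          [set x : 'cV[K']_g | T1 p absK' e x /\
             absK' (x (last_ord g_gt0) 0) = torsion_radius p absK']].
Proof.
have QpP := padic_nonarch Qp_padic.
have KP : nonarch_absval absK := extends_nonarch absK_ext.
have pE (F : fieldType) (L : fieldExtType F) : p%:R = (p%:R)%:A :> L.
  by rewrite scaler_nat.
have pK_lt1 : absK p%:R < 1.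
  by rewrite pE (extends_alg absK_ext) (padic_abs_p_lt1 p_prime Qp_padic).
have charK n : (0 < n)%N -> n%:R != 0 :> K.
  move=> n0; rewrite -(rmorph_nat (in_alg K)) fmorph_eq0.
  exact: padic_natr_neq0 p_prime Qp_padic n n0.
have e_int k : mxint absK (e k) by move=> i j; have [/(_ i)] := e_frob k j.
have e1_abs := integer_units_abs KP e1_unit.
have [T [cls clsP]] := residues_finite p_prime Qp_padic absK_ext.
have [n n0 period] := frob_iter_period KP p_prime pK_lt1 (e_int 1%N) e1_abs clsP.
have pn1 : (0 < (p ^ n).-1)%N.
  by rewrite -ltnS prednK ?expn_gt0 ?prime_gt0// -(exp1n n) ltn_exp2r ?prime_gt1.
have p1 : (0 < p.-1)%N by rewrite -ltnS prednK ?prime_gt0// prime_gt1.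
have [L [w [z [wE z_prim]]]] := kummer_extension (- p%:R) p1 (charK _ pn1).
have [absL absL_ext] := absval_extension L KP (charK _ (prime_gt0 p_prime)) pK_lt1.
exists L, absL.
have LP : nonarch_absval absL := extends_nonarch absL_ext.
have pL_lt1 : absL p%:R < 1 by rewrite pE (extends_alg absL_ext).
have pL0 : p%:R != 0 :> L.
  by rewrite -(rmorph_nat (in_alg L)) fmorph_eq0 charK ?prime_gt0.
have wE' : w ^+ p.-1 = - p%:R by rewrite wE scaleNr -pE.
have L_complete : absval_complete absL.
  apply: (extension_complete absL_ext) => //.
  by apply: (extension_complete absK_ext) => //; exact: padic_complete Qp_padic.
have E_int k : mxint absL (map_mx (in_alg L) (e k)).
  by move=> i j; rewrite mxE /= (extends_alg absL_ext); exact: e_int.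
have iterE i : frob_iter p (map_mx (in_alg L) (e 1%N)) i =
    map_mx (in_alg L) (frob_iter p (e 1%N) i).
  elim: i => [|i IH] /=; first by rewrite map_mx1.
  rewrite IH map_mxM; congr (_ *m _); apply/matrixP => k l.
  by rewrite !mxE [RHS]rmorphXn.
have periodL : mxclose absL (frob_iter p (map_mx (in_alg L) (e 1%N)) n) 1%:M.
  rewrite iterE -(map_mx1 (in_alg L)) => i j.
  rewrite ![map_mx _ _ _ _]mxE -rmorphB /= (extends_alg absL_ext); exact: period.
have [U [U_int U_unit U_frob]] :=
  frobenius_basis LP p_prime pL_lt1 (E_int 1%N) n0 periodL z_prim.
have e0 := frobenius_matrix0 A_subalg mu_gaps e_frob.
split=> //.
- exact: (card_T1 LP L_complete p_prime pL_lt1 pL0 wE' e0 E_int U_int U_unit U_frob).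
- exact: (card_T1_coord LP L_complete p_prime pL_lt1 pL0 wE' e0 E_int U_int U_unit U_frob).
Qed.
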